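(* Let $\mathcal{G}=(V,E)$ be a finite undirected graph with $V=\{1,\dots,d\}$, $d\ge 1$, and let $r$ be the number of vertices of the largest clique of $\mathcal{G}$. Let $0<\varepsilon<2+r$. Then there is no estimator $\hat p_n$ (a sequence of density estimators on $[0,1]^d$, with $\hat p_n$ a function of $n$ i.i.d. samples) such that, for every Lipschitz continuous probability density $p$ on $[0,1]^d$ satisfying the Markov property with respect to $\mathcal{G}$, $$\|p-\hat p_n\|_1\in O_p\big(n^{-1/(2+r-\varepsilon)}\big)\quad\text{as }n\to\infty$$ when $\hat p_n$ is computed from $n$ i.i.d. samples from $p$.
   Context: The data domain is $[0,1]^d$ with Lebesgue measure; $\|\cdot\|_1$ is the $L^1$ norm. A density $p$ on $[0,1]^d$ is Lipschitz continuous if for some $L\ge 0$, $|p(x)-p(y)|\le L\|x-y\|_2$ for all $x,y$. A clique is a set of pairwise adjacent vertices. Markov property: a density $p$ of a random vector $X=(X_1,\dots,X_d)$ satisfies the Markov property with respect to $\mathcal{G}$ if for all disjoint $A,B,C\subset\{1,\dots,d\}$ such that every path in $\mathcal{G}$ from $A$ to $B$ passes through $C$, $X_A$ and $X_B$ are conditionally independent given $X_C$. $Z_n\in O_p(a_n)$ means that $Z_n/a_n$ is bounded in probability; the constants may depend on $p$ and $\mathcal{G}$. *)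

(* Defs.v *)
From HB Require Import structures.
From mathcomp Require Import all_boot all_order all_algebra.
From mathcomp Require Import all_classical all_reals all_analysis.
From mathcomp Require Import measurable_realfun.
Set Implicit Arguments.
Unset Strict Implicit.
Unset Printing Implicit Defensive.
Import Order.TTheory GRing.Theory Num.Theory.
Import numFieldNormedType.Exports.
Local Open Scope classical_set_scope.
Local Open Scope ring_scope.
Local Open Scope ereal_scope.

Section product_cons.
Context {disp : measure_display} {T : measurableType disp} {R : realType}.
Variable n : nat.

Definition tuple_cons (z : T * n.-tuple T) : n.+1.-tuple T :=
  [tuple of z.1 :: z.2].

Definition tuple_uncons (t : n.+1.-tuple T) : T * n.-tuple T :=
  (thead t, [tuple of behead t]).

Lemma measurable_tuple_cons : measurable_fun setT tuple_cons.
Proof. exact: (measurable_cons measurable_fst measurable_snd). Qed.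

Lemma measurable_tuple_uncons : measurable_fun setT tuple_uncons.
Proof.
apply/measurable_fun_pairP; split; last exact: measurable_behead.
exact: (measurable_tnth ord0).
Qed.

Lemma tuple_consK : cancel tuple_cons tuple_uncons.
Proof. by move=> [x t]; congr pair; apply: val_inj. Qed.

Definition product_cons (m1 : set T -> \bar R) (m2 : set (n.-tuple T) -> \bar R)
  : set (n.+1.-tuple T) -> \bar R := pushforward (m1 \x m2) tuple_cons.

Variables (m1 : {sigma_finite_measure set T -> \bar R})
          (m2 : {sigma_finite_measure set (n.-tuple T) -> \bar R}).

HB.instance Definition _ := Measure.copy (product_cons m1 m2)
  (measure_function_pushforward__canonical__measure_function_Measure
     (lebesgue_integral_fubini_product_measure1__canonical__measure_function_Measure m1 m2)
     measurable_tuple_cons).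

Let product_cons_sigma_finite : sigma_finite setT (product_cons m1 m2).
Proof.
have /sigma_finiteP[F [TF ndF Foo]] := sigma_finiteT m1.
have /sigma_finiteP[G [TG ndG Goo]] := sigma_finiteT m2.
exists (fun k => tuple_uncons @^-1` (F k `*` G k)).
  rewrite -preimage_bigcup (_ : \bigcup_k _ = setT) ?preimage_setT//.
  rewrite -setXTT TF TG predeqE => -[x y]; split.
    by move=> [k _ []/= ? ?]; split; exists k.
  move=> [/= [k _ Fkx] [l _ Gly]]; exists (maxn k l) => //; split.
  - by move: x Fkx; exact/subsetPset/ndF/leq_maxl.
  - by move: y Gly; exact/subsetPset/ndG/leq_maxr.
move=> k; have [? ?] := Foo k; have [? ?] := Goo k; split.
  rewrite -[X in measurable X]setTI.
  by apply: measurable_tuple_uncons => //; exact: measurableX.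
rewrite /product_cons /pushforward -comp_preimage.
rewrite (_ : _ \o _ = id) ?preimage_id; last exact/funext/tuple_consK.
by rewrite product_measure1E// lte_mul_pinfty// ge0_fin_numE.
Qed.

HB.instance Definition _ := Measure_isSigmaFinite.Build _ _ _
  (product_cons m1 m2) product_cons_sigma_finite.

End product_cons.

Section power_measure.
Context {disp : measure_display} {T : measurableType disp} {R : realType}.

(* The n-fold product measure of [mu], on the n-tuples over [T]. *)
Fixpoint power_measure (mu : set T -> \bar R) (n : nat) :
    set (n.-tuple T) -> \bar R :=
  match n with
  | 0%N => dirac [tuple]
  | m.+1 => product_cons mu (@power_measure mu m)
  end.

Arguments power_measure : clear implicits.

Variables (mu : {sigma_finite_measure set T -> \bar R}) (n : nat).

Let power_measureE :
  exists m : {sigma_finite_measure set (n.-tuple T) -> \bar R},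
    power_measure mu n = m :> (set (n.-tuple T) -> \bar R).
Proof.
elim: n => [|k [m mE]] /=; first by exists (dirac ([tuple] : 0.-tuple T)).
by rewrite mE; exists (product_cons mu m).
Qed.

Let power0 : power_measure mu n set0 = 0.
Proof. by have [m ->] := power_measureE; exact: measure0. Qed.

Let power_ge0 A : 0 <= power_measure mu n A.
Proof. by have [m ->] := power_measureE; exact: measure_ge0. Qed.

Let power_sigma_additive : semi_sigma_additive (power_measure mu n).
Proof.
by have [m ->] := power_measureE; exact: measure_semi_sigma_additive.
Qed.

HB.instance Definition _ := isMeasure.Build _ _ _ (power_measure mu n)
  power0 power_ge0 power_sigma_additive.

Let power_sigma_finite : sigma_finite setT (power_measure mu n).
Proof. by have [m ->] := power_measureE; exact: sigma_finiteT. Qed.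

HB.instance Definition _ := Measure_isSigmaFinite.Build _ _ _
  (power_measure mu n) power_sigma_finite.

End power_measure.
Arguments power_measure {disp T R} mu n.

Section densities.
Variables (R : realType) (d : nat).

Definition Rd := d.-tuple (measurableTypeR R).

Definition lebesgue_Rd : set Rd -> \bar R :=
  power_measure (@lebesgue_measure R) d.

HB.instance Definition _ := SigmaFiniteMeasure.on lebesgue_Rd.

Definition unit_cube : set Rd :=
  [set x | forall i : 'I_d, (0 <= tnth x i <= 1)%R].

Lemma measurable_unit_cube : measurable unit_cube.
Proof.
have -> : unit_cube =
    \bigcap_(i in [set: 'I_d]) ((fun x : Rd => tnth x i) @^-1` `[0%R, 1%R]).
  apply/seteqP; split => x /= xI i; first by rewrite /= in_itv/= => _; exact: xI.
  by have := xI i I; rewrite /= in_itv.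
apply: fin_bigcap_measurable; first exact: finite_finset.
move=> i _; rewrite -[X in measurable X]setTI.
by apply: measurable_tnth => //; exact: measurable_itv.
Qed.

(* The values of [pdf] outside of the cube are irrelevant. *)
Record density := Density {
  pdf :> Rd -> R ;
  measurable_pdf : measurable_fun unit_cube pdf ;
  pdf_ge0 : forall x, unit_cube x -> (0 <= pdf x)%R ;
  integral_pdf : \int[lebesgue_Rd]_(x in unit_cube) (pdf x)%:E = 1 }.

Definition density_law (p : density) (A : set Rd) : \bar R :=
  \int[lebesgue_Rd]_(x in A `&` unit_cube) (p x)%:E.

Section density_law_probability.
Variable p : density.

Let law0 : density_law p set0 = 0.
Proof. by rewrite /density_law set0I integral_set0. Qed.

Let law_ge0 A : 0 <= density_law p A.
Proof.
by apply: integral_ge0 => x [_ cx]; rewrite lee_fin; exact: pdf_ge0.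
Qed.

Let law_sigma_additive : semi_sigma_additive (density_law p).
Proof.
move=> F mF tF mUF; rewrite /density_law; apply: cvg_toP.
  apply: ereal_nondecreasing_is_cvgn => m n mn.
  by apply: lee_sum_nneg_natr => // k _ _; exact: law_ge0.
rewrite setI_bigcupl ge0_integral_bigcup//=.
- by move=> k; apply: measurableI => //; exact: measurable_unit_cube.
- apply/measurable_EFinP; apply: measurable_funS (measurable_pdf p).
    exact: measurable_unit_cube.
  by move=> x [k _ []].
- by move=> x [k _ [_ cx]]; rewrite lee_fin; exact: pdf_ge0.
- exact: trivIset_setIr.
Qed.

HB.instance Definition _ := isMeasure.Build _ _ _ (density_law p)
  law0 law_ge0 law_sigma_additive.

Let law_setT : density_law p setT = 1.
Proof. by rewrite /density_law setTI integral_pdf. Qed.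

HB.instance Definition _ :=
  Measure_isProbability.Build _ _ _ (density_law p) law_setT.

End density_law_probability.

Definition euclidean_dist (x y : Rd) : R :=
  Num.sqrt (\sum_(i < d) (tnth x i - tnth y i) ^+ 2)%R.

Definition lipschitz_density (p : density) : Prop :=
  exists2 L : R, (0 <= L)%R & forall x y, unit_cube x -> unit_cube y ->
    (`|p x - p y| <= L * euclidean_dist x y)%R.

Definition L1_dist (f g : Rd -> R) : \bar R :=
  \int[lebesgue_Rd]_(x in unit_cube) `|f x - g x|%:E.

End densities.

Section conditional_independence.
Context {disp d1 d2 d3 : measure_display} {Omega : measurableType disp}.
Context {T1 : measurableType d1} {T2 : measurableType d2}.
Context {T3 : measurableType d3} {R : realType}.
Variable P : probability Omega R.

(* [f] is a version of the conditional probability of [E] given [Z], that is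
   [P (E | Z) = f Z] almost surely. *)
Definition is_cond_prob (Z : Omega -> T3) (E : set Omega) (f : T3 -> R) :=
  [/\ measurable_fun setT f,
      P.-integrable setT (fun w => (f (Z w))%:E) &
      forall U : set T3, measurable U ->
        \int[P]_(w in Z @^-1` U) (f (Z w))%:E = P (E `&` Z @^-1` U)].

(* P (X in S, Y in S' | Z) = P (X in S | Z) P (Y in S' | Z) almost surely.
   As conditional probabilities given [Z] exist and are almost surely unique,
   it does not matter which versions [f] and [g] are chosen. *)
Definition cond_independent (X : Omega -> T1) (Y : Omega -> T2)
    (Z : Omega -> T3) :=
  forall (S : set T1) (S' : set T2), measurable S -> measurable S' ->
  exists f g : T3 -> R,
    [/\ is_cond_prob Z (X @^-1` S) f, is_cond_prob Z (Y @^-1` S') g &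
        is_cond_prob Z (X @^-1` S `&` Y @^-1` S') (fun z => f z * g z)%R].

End conditional_independence.

(* A graph on the vertices ['I_d] is given by its adjacency relation; loops,
   if there are any, play no role below. *)
Section graphs.
Variables (d : nat) (e : rel 'I_d).

Definition clique (K : {set 'I_d}) : bool :=
  [forall i in K, forall j in K, (i != j) ==> e i j].

Definition clique_number : nat := \max_(K : {set 'I_d} | clique K) #|K|.

(* Walks with repeated vertices are allowed as paths from [A] to [B]; this does
   not change the notion, since such a walk contains a path. *)
Definition separates (C A B : {set 'I_d}) : Prop :=
  forall (a : 'I_d) (s : seq 'I_d), a \in A -> path e a s -> last a s \in B ->
  exists2 c, c \in a :: s & c \in C.

End graphs.

Definition subvector (R : realType) (d : nat) (A : {set 'I_d}) (x : Rd R d) :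
    Rd R #|A| :=
  [tuple tnth x (enum_val i) | i < #|A|].

Definition markov_property (R : realType) (d : nat) (e : rel 'I_d)
    (p : density R d) : Prop :=
  forall A B C : {set 'I_d},
    [disjoint A & B]%B -> [disjoint A & C]%B -> [disjoint B & C]%B ->
    separates e C A B ->
    cond_independent (density_law p)
      (@subvector R d A) (@subvector R d B) (@subvector R d C).

(* [Z n / a n] is bounded in probability, where [Z n] is a random variable on
   a space with law [P n], for [a n > 0]. *)
Definition bigO_proba (R : realType) (disp : nat -> measure_display)
    (Omega : forall n, measurableType (disp n))
    (P : forall n, set (Omega n) -> \bar R)
    (Z : forall n, Omega n -> \bar R) (a : nat -> R) : Prop :=
  forall delta : R, (0 < delta)%R -> exists M : R,
    \forall n \near \oo, P n [set w | (M * a n)%:E < `|Z n w|] <= delta%:E.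

(* A sequence of estimators: [phat n t] is the estimate based on the sample [t]
   of size [n]. An estimate is not required to be itself a density. *)
Definition estimator (R : realType) (d : nat) :=
  forall n : nat, n.-tuple (Rd R d) -> Rd R d -> R.

Definition measurable_estimator (R : realType) (d : nat)
    (phat : estimator R d) : Prop :=
  forall n, measurable_fun setT
    (fun tx : n.-tuple (Rd R d) * Rd R d => phat n tx.1 tx.2).

(* Main.v *)
Require Import Defs.
From HB Require Import structures.
From mathcomp Require Import all_boot all_order all_algebra.
From mathcomp Require Import all_classical all_reals all_analysis.
From mathcomp Require Import measurable_realfun ring lra.
Import Order.TTheory GRing.Theory Num.Theory.
Import numFieldNormedType.Exports.
Set Implicit Arguments.
Unset Strict Implicit.
Unset Printing Implicit Defensive.
Local Open Scope classical_set_scope.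
Local Open Scope ring_scope.

(* A density that depends only on the coordinates of a maximal clique [K] has the
   Markov property: of two sets separated by a third one, at least one is disjoint
   from [K], and its coordinates are uniform and independent of all the others.
   On these [r = #|K|] coordinates, cut the cube into [N ^ r] cells and add to a
   density [q], with arbitrary signs, bumps of height [c / N] and mean zero on the
   cells. For [n = N ^ (2 + r)] a sample does not reveal the sign of a given bump,
   so by Assouad's argument every estimator misses, for some choice of the signs
   and with probability at least [1 / 8], by a constant multiple of [1 / N], which
   exceeds any multiple of [n ^ (- 1 / (2 + r - eps))] when [N] is large.
   As the constants in [O_p] may depend on the density, a single density must
   defeat the estimator at infinitely many sample sizes. It is obtained as the
   limit of a sequence of such perturbations, each so small that it does not spoil
   the lower bounds at the sample sizes treated before: if the limit [p] satisfies
   [p >= (1 - 2 z) q], then [p ^ n >= (1 - 2 n z) q ^ n] for the product densities. *)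

(** * Integration against product measures *)

(** The scales are forced. Height [c / N] on cells of side [1 / N] keeps the Lipschitz constant
    bounded. Flipping one sign changes the density by a function whose square has integral of order
    [N ^ (- 2 - r)], so at [n = N ^ (2 + r)] the two product laws stay at bounded chi-square
    divergence. A flip also moves the density by order [N ^ (- 1 - r)] in L1, so errors on a fixed
    share of the [N ^ r] cells add up to order [1 / N]. [O_p] bounds probabilities, not
    expectations; hence the cells that are badly estimated are counted, instead of averaging the
    loss. All densities stay above [1 / 2]. This bounds the weight [1 / q] in the chi-square
    divergence, and it turns a uniform distance [z] between two densities into the multiplicative
    bound used for the limit. That bound is one-sided, which is enough because only lower bounds on
    probabilities have to survive. A budget, at least halved at every stage, pays for the height and
    the slope of all later perturbations. *)

Section density_integral.
Context {disp : measure_display} {T : measurableType disp} {R : realType}.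
Local Open Scope ereal_scope.

(** Both [g] and the Radon-Nikodym derivative of [nu] integrate to [nu] on every measurable set, so
    they agree almost everywhere and the change of variables known for the derivative applies to
    [g]. *)
Lemma ge0_integral_density (mu : {sigma_finite_measure set T -> \bar R})
    (nu : {finite_measure set T -> \bar R}) (g : T -> R) (f : T -> \bar R) :
  measurable_fun setT g -> (forall x, 0 <= g x)%R ->
  (forall A, measurable A -> nu A = \int[mu]_(x in A) (g x)%:E) ->
  measurable_fun setT f -> (forall x, 0 <= f x) ->
  \int[nu]_x f x = \int[mu]_x (f x * (g x)%:E).
Proof.
move=> mg g0 nuE mf f0.
have numu : nu `<< mu.
  apply/null_content_dominatesP => A mA muA0.
  by rewrite nuE// null_set_integral//; exact/measurable_EFinP/measurable_funTS.
rewrite -(Radon_Nikodym_SigmaFinite.change_of_variables numu)//.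
apply: ae_eq_integral => //.
- apply: emeasurable_funM => //.
  exact: measurable_int (Radon_Nikodym_SigmaFinite.f_integrable numu).
- by apply: emeasurable_funM => //; exact/measurable_EFinP.
have ig : mu.-integrable setT (EFin \o g).
  apply/integrableP; split; first exact/measurable_EFinP.
  under eq_integral do rewrite /= ger0_norm//.
  by rewrite -nuE// ltey_eq fin_num_measure.
have : ae_eq mu setT (Radon_Nikodym_SigmaFinite.f nu mu) (EFin \o g).
  apply: integral_ae_eq => //.
  - exact: Radon_Nikodym_SigmaFinite.f_integrable.
  - exact/measurable_EFinP.
  - move=> E _ mE.
    by rewrite -(Radon_Nikodym_SigmaFinite.f_integral numu)// nuE.
by apply: filterS => x /= h _; rewrite h.
Qed.

End density_integral.

Section power_measure_theory.
Context {disp : measure_display} {T : measurableType disp} {R : realType}.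
Local Open Scope ereal_scope.
Implicit Type m : {sigma_finite_measure set T -> \bar R}.

Lemma ge0_integral_power0 m (f : 0.-tuple T -> \bar R) :
  (forall t, 0 <= f t) ->
  \int[power_measure m 0]_t f t = f [tuple].
Proof.
move=> f0 /=.
rewrite (eq_integral (cst (f [tuple]))); last by move=> t _; rewrite tuple0.
by rewrite integral_cst//= diracT mule1.
Qed.

Lemma ge0_integral_powerS m n (f : n.+1.-tuple T -> \bar R) :
  measurable_fun setT f -> (forall t, 0 <= f t) ->
  \int[power_measure m n.+1]_t f t =
  \int[m]_x \int[power_measure m n]_t f [tuple of x :: t].
Proof.
move=> mf f0.
rewrite /= /product_cons.
rewrite (ge0_integral_pushforward (@measurable_tuple_cons _ T n)
  (m \x power_measure m n)%E)//.
rewrite preimage_setT fubini_tonelli1//.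
  by apply: measurableT_comp => //; exact: measurable_tuple_cons.
by move=> x; exact: f0.
Qed.

Lemma measurable_integral_cons m n (f : n.+1.-tuple T -> \bar R) :
  measurable_fun setT f -> (forall t, 0 <= f t) ->
  measurable_fun setT
    (fun x => \int[power_measure m n]_t f [tuple of x :: t]).
Proof.
move=> mf f0.
apply: (measurable_fun_fubini_tonelli_F (m2 := power_measure m n)
  (f \o @tuple_cons _ T n)) => //=.
  by apply: measurableT_comp => //; exact: measurable_tuple_cons.
Qed.

Lemma measurable_cons_section n (x : T) :
  measurable_fun setT (fun t : n.-tuple T => [tuple of x :: t]).
Proof. exact: measurable_cons. Qed.

Lemma ge0_integral_power_prod m n (g : 'I_n -> T -> R) (c : 'I_n -> R) :
  (forall i, measurable_fun setT (g i)) -> (forall i x, 0 <= g i x)%R ->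
  (forall i, \int[m]_x (g i x)%:E = (c i)%:E) ->
  \int[power_measure m n]_t (\prod_(i < n) g i (tnth t i))%:E =
  (\prod_(i < n) c i)%:E.
Proof.
elim: n g c => [|n IH] g c mg g0 gc.
  rewrite ge0_integral_power0 ?big_ord0// => t.
  by rewrite big_ord0 lee_fin.
have prod_ge0 k (h : 'I_k -> T -> R) (t : k.-tuple T) :
    (forall i x, 0 <= h i x)%R -> (0 <= \prod_(i < k) h i (tnth t i))%R.
  by move=> h0; apply: prodr_ge0.
have mprod k (h : 'I_k -> T -> R) : (forall i, measurable_fun setT (h i)) ->
    measurable_fun setT
      (fun t : k.-tuple T => (\prod_(i < k) h i (tnth t i))%:E).
  move=> mh; apply/measurable_EFinP; apply: measurable_prod => i _.
  by apply: measurableT_comp => //; exact: measurable_tnth.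
rewrite ge0_integral_powerS//; last 2 first.
- exact: mprod.
- by move=> t; rewrite lee_fin; apply: prodr_ge0.
under eq_integral => x _.
  under eq_integral => t _.
    rewrite big_ord_recl/=.
    under eq_bigr do rewrite tnthS.
    rewrite tnth0 EFinM; over.
  rewrite /= ge0_integralZl//; last 3 first.
  - exact: (mprod _ (fun i => g (lift ord0 i))).
  - by move=> t _; rewrite lee_fin; apply: prodr_ge0.
  - by rewrite lee_fin.
  rewrite (IH (fun i => g (lift ord0 i)) (fun i => c (lift ord0 i)))//.
  over.
rewrite /= ge0_integralZr//.
- by rewrite gc -EFinM big_ord_recl.
- exact/measurable_EFinP.
- by move=> x _; rewrite lee_fin.
- rewrite lee_fin; apply: prodr_ge0 => i _.
  by rewrite -lee_fin -gc; apply: integral_ge0 => x _; rewrite lee_fin.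
Qed.

(** The likelihood of the sample [t]: the density of the [n]-fold product law with respect to the
    power of the base measure. *)
Definition lik n (q : T -> R) (t : n.-tuple T) : R :=
  (\prod_(i < n) q (tnth t i))%R.

Lemma lik_cons n (q : T -> R) x (t : n.-tuple T) :
  lik q [tuple of x :: t] = (q x * lik q t)%R.
Proof.
by rewrite /lik big_ord_recl tnth0; under eq_bigr do rewrite tnthS.
Qed.

Lemma lik_ge0 n (q : T -> R) (t : n.-tuple T) :
  (forall x, 0 <= q x)%R -> (0 <= lik q t)%R.
Proof. by move=> q0; apply: prodr_ge0. Qed.

Lemma measurable_lik n (q : T -> R) : measurable_fun setT q ->
  measurable_fun setT (@lik n q).
Proof.
move=> mq; apply: measurable_prod => i _.
by apply: measurableT_comp => //; exact: measurable_tnth.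
Qed.

Lemma integral_lik m n (q : T -> R) (c : R) :
  measurable_fun setT q -> (forall x, 0 <= q x)%R ->
  \int[m]_x (q x)%:E = c%:E ->
  \int[power_measure m n]_t (lik q t)%:E = (c ^+ n)%:E.
Proof.
move=> mq q0 qc; rewrite (@ge0_integral_power_prod m n (fun=> q) (fun=> c))//.
by rewrite prodr_const card_ord.
Qed.

Lemma ge0_integral_power_density m (nu : probability T R) (g : T -> R) n
    (f : n.-tuple T -> \bar R) :
  measurable_fun setT g -> (forall x, 0 <= g x)%R ->
  (forall A, measurable A -> nu A = \int[m]_(x in A) (g x)%:E) ->
  measurable_fun setT f -> (forall x, 0 <= f x) ->
  \int[power_measure nu n]_t f t = \int[power_measure m n]_t (f t * (lik g t)%:E).
Proof.
move=> mg g0 nuE; elim: n f => [|n IH] f mf f0.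
  rewrite (@ge0_integral_power0 nu)// (@ge0_integral_power0 m)//.
    by rewrite /lik big_ord0 mule1.
  by move=> t; rewrite mule_ge0// lee_fin lik_ge0.
rewrite (@ge0_integral_powerS nu)// (@ge0_integral_powerS m)//; last 2 first.
- apply: emeasurable_funM => //; apply/measurable_EFinP; exact: measurable_lik.
- by move=> t; rewrite mule_ge0// lee_fin lik_ge0.
under eq_integral => x _.
  rewrite IH//; last first.
    by apply: (measurableT_comp mf); exact: measurable_cons_section.
  over.
rewrite /= (@ge0_integral_density _ _ _ m nu g)//; last 2 first.
(* The inner integrand is recast as a function of the whole tuple, the form in which
   [measurable_integral_cons] gives measurability in the head. *)
- pose F (t : n.+1.-tuple T) := f t * (lik g [tuple of behead t])%:E.
  have mF : measurable_fun setT F.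
    apply: emeasurable_funM => //; apply/measurable_EFinP.
    by apply: (measurableT_comp (@measurable_lik n _ mg)); exact: measurable_behead.
  have F0 t : 0 <= F t by rewrite mule_ge0// lee_fin lik_ge0.
  have := @measurable_integral_cons m n F mF F0; apply: eq_measurable_fun => x _.
  apply: eq_integral => t _; rewrite /F; congr (_ * (lik _ _)%:E).
  exact: val_inj.
- by move=> x; apply: integral_ge0 => t _; rewrite mule_ge0// lee_fin lik_ge0.
apply: eq_integral => x _; rewrite -ge0_integralZr//.
- by apply: eq_integral => t _; rewrite lik_cons EFinM -muleA (muleC (lik _ _)%:E).
- apply: emeasurable_funM; last by apply/measurable_EFinP; exact: measurable_lik.
  by apply: (measurableT_comp mf); exact: measurable_cons_section.
- by move=> t _; rewrite mule_ge0// lee_fin lik_ge0.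
- by rewrite lee_fin.
Qed.

Definition depends_on {U : Type} n (A : pred 'I_n) (f : n.-tuple T -> U) :=
  forall s t, (forall i, A i -> tnth s i = tnth t i) -> f s = f t.

Lemma depends_on_cons {U : Type} n (A : pred 'I_n.+1) (f : n.+1.-tuple T -> U) x :
  depends_on A f ->
  depends_on (fun i => A (lift ord0 i)) (fun t => f [tuple of x :: t]).
Proof.
move=> Af s t st; apply: Af => i.
case: (unliftP ord0 i) => [j ->|->] Ai; last by rewrite !tnth0.
by rewrite !tnthS st.
Qed.

Lemma depends_on_head {U : Type} n (A : pred 'I_n.+1) (f : n.+1.-tuple T -> U) x y
    (t : n.-tuple T) :
  depends_on A f -> ~~ A ord0 -> f [tuple of x :: t] = f [tuple of y :: t].
Proof.
move=> Af A0; apply: Af => i; case: (unliftP ord0 i) => [j ->|->] Ai.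
  by rewrite !tnthS.
by rewrite Ai in A0.
Qed.

(** Disjoint blocks of coordinates are independent. In the induction the head coordinate belongs to
    one block only; the inner integral of the other function is then constant in the head and leaves
    the outer integral, total mass one making it equal to the full integral of that function. *)
Lemma ge0_integral_power_indep m n (A : pred 'I_n) (f g : n.-tuple T -> \bar R) :
  m setT = 1 ->
  measurable_fun setT f -> (forall t, 0 <= f t) -> depends_on A f ->
  measurable_fun setT g -> (forall t, 0 <= g t) -> depends_on (predC A) g ->
  \int[power_measure m n]_t (f t * g t) =
  \int[power_measure m n]_t f t * \int[power_measure m n]_t g t.
Proof.
move=> m1; elim: n A f g => [|n IH] A f g mf f0 Af mg g0 Ag.
  by rewrite !ge0_integral_power0// => t; rewrite mule_ge0.
have sec h x : measurable_fun setT h ->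
    measurable_fun setT (fun t : n.-tuple T => h [tuple of x :: t] : \bar R).
  by move=> mh; apply: (measurableT_comp mh); exact: measurable_cons_section.
rewrite !ge0_integral_powerS//; last 2 first.
- exact: emeasurable_funM.
- by move=> t; rewrite mule_ge0.
under eq_integral => x _.
  rewrite (IH (fun i => A (lift ord0 i)) (fun t => f [tuple of x :: t])
    (fun t => g [tuple of x :: t]))//; [|exact: sec|exact: depends_on_cons
    |exact: sec|exact: (@depends_on_cons _ _ (predC A))].
  over.
have [x0 _] : [set: T] !=set0.
  by apply/set0P/eqP => T0; move: m1; rewrite T0 measure0 => /esym/eqP;
    rewrite onee_eq0.
have I0 h x : (forall t, 0 <= h t) ->
    0 <= \int[power_measure m n]_t h [tuple of x :: t].
  by move=> h0; apply: integral_ge0.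
case/boolP : (A ord0) => A0 /=.
  have gE x : \int[power_measure m n]_t g [tuple of x :: t] =
      \int[power_measure m n]_t g [tuple of x0 :: t].
    apply: eq_integral => t _; apply: (depends_on_head _ _ _ Ag).
    by rewrite /= A0.
  under eq_integral do rewrite gE.
  under [X in _ = _ * X]eq_integral do rewrite gE.
  set c := \int[_]_t g _.
  have -> : \int[m]_x c = c by rewrite (integral_cst m measurableT c) [X in _ * X]m1 mule1.
  rewrite ge0_integralZr//.
  - exact: measurable_integral_cons.
  - by move=> x _; exact: I0.
  - exact: I0.
have fE x : \int[power_measure m n]_t f [tuple of x :: t] =
    \int[power_measure m n]_t f [tuple of x0 :: t].
  by apply: eq_integral => t _; apply: (depends_on_head _ _ _ Af).
under eq_integral do rewrite fE.
under [X in _ = X * _]eq_integral do rewrite fE.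
set c := \int[_]_t f _.
have -> : \int[m]_x c = c by rewrite (integral_cst m measurableT c) [X in _ * X]m1 mule1.
rewrite ge0_integralZl//.
- exact: measurable_integral_cons.
- by move=> x _; exact: I0.
- exact: I0.
Qed.

End power_measure_theory.

(** * Assouad's lower bound *)

Section flip.
Context {J : finType}.

Definition flip (j : J) (s : {ffun J -> bool}) : {ffun J -> bool} :=
  [ffun k => if k == j then ~~ s k else s k].

Lemma flipK j : involutive (flip j).
Proof.
by move=> s; apply/ffunP => k; rewrite !ffunE; case: eqP => // _; rewrite negbK.
Qed.

(** Averaging over all sign vectors: for fixed [j], the involution [flip j] pairs them up, so the
    mean of [a _ j] is at least [c / 2], and some vector does at least as well as the mean. *)
Lemma exists_flip_average (R : realFieldType) (c : R) (a : {ffun J -> bool} -> J -> R) :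
  (forall s j, c <= a s j + a (flip j s) j) ->
  exists s, c / 2 * #|J|%:R <= \sum_j a s j.
Proof.
move=> ca; apply/not_existsP => small.
have lt_s s : \sum_j a s j < c / 2 * #|J|%:R.
  by rewrite ltNge; apply/negP; exact: small.
pose S := \sum_s \sum_j a s j.
have S_lt : S < \sum_(s : {ffun J -> bool}) (c / 2 * #|J|%:R).
  apply: ltr_sum; last by move=> s _; exact: lt_s.
  by apply/hasP; exists [ffun=> true] => //; rewrite mem_index_enum.
have S_ge : \sum_(s : {ffun J -> bool}) (c / 2 * #|J|%:R) <= S.
  have -> : \sum_(s : {ffun J -> bool}) (c / 2 * #|J|%:R) =
      \sum_(j : J) \sum_(s : {ffun J -> bool}) c / 2.
    by rewrite exchange_big/=; apply: eq_bigr => s _; rewrite sumr_const mulr_natr.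
  rewrite /S [leRHS]exchange_big/=; apply: ler_sum => j _.
  have E : \sum_s a s j = \sum_s a (flip j s) j.
    by rewrite [LHS](reindex_inj (inv_inj (flipK j))).
  suff : \sum_(s : {ffun J -> bool}) c <= \sum_s a s j + \sum_s a s j.
    by rewrite -mulr_suml; lra.
  by rewrite [X in _ + X]E -big_split/=; apply: ler_sum => s _; exact: ca.
by move: (lt_le_trans S_lt S_ge); rewrite ltxx.
Qed.

End flip.

Section assouad.
Context {disp : measure_display} {T : measurableType disp} {R : realType}.
Variables (m : {sigma_finite_measure set T -> \bar R}) (n : nat).
Implicit Types (q : T -> R) (A : set (n.-tuple T)).
Local Open Scope ereal_scope.

(** The probability of [A] under [n] independent draws from the density [q], kept as an integral so
    that the many perturbed densities need not each be made into a probability measure. *)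
Definition lik_mass (q : T -> R) (A : set (n.-tuple T)) : \bar R :=
  \int[power_measure m n]_t (\1_A t * lik q t)%:E.

Lemma lik_mass_ge0 q A : (forall x, 0 <= q x)%R -> 0 <= lik_mass q A.
Proof.
move=> q0; apply: integral_ge0 => t _.
by rewrite lee_fin mulr_ge0// lik_ge0.
Qed.

Lemma measurable_indic_lik q A : measurable_fun setT q -> measurable A ->
  measurable_fun setT (fun t : n.-tuple T => (\1_A t * lik q t)%:E).
Proof.
move=> mq mA; apply/measurable_EFinP; apply: measurable_funM.
  exact: measurable_indic.
exact: measurable_lik.
Qed.

Lemma lik_mass_le1 q A : measurable_fun setT q -> (forall x, 0 <= q x)%R ->
  \int[m]_x (q x)%:E = 1 -> measurable A -> lik_mass q A <= 1.
Proof.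
move=> mq q0 q1 mA.
have <- : \int[power_measure m n]_t (lik q t)%:E = 1.
  by rewrite (integral_lik n (c := 1%R))// expr1n.
apply: ge0_le_integral => //.
- by move=> t _; rewrite lee_fin mulr_ge0// lik_ge0.
- exact: measurable_indic_lik.
- by apply/measurable_EFinP; exact: measurable_lik.
- move=> t _; rewrite lee_fin ler_piMl ?lik_ge0// indicE; case: (_ \in _).
Qed.

Lemma lik_mass_fin_num q A : measurable_fun setT q -> (forall x, 0 <= q x)%R ->
  \int[m]_x (q x)%:E = 1 -> measurable A -> lik_mass q A \is a fin_num.
Proof.
move=> mq q0 q1 mA; rewrite ge0_fin_numE ?lik_mass_ge0//.
by apply: le_lt_trans (lik_mass_le1 mq q0 q1 mA) _; rewrite ltry.
Qed.

(* The chi-square divergence between the two product laws is controlled by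
   [w = p^2 / q], whose integral is [1 + \int (p - q)^2 / q]. *)
Lemma lik_mass_two_point (p q : T -> R) (v : R) (A B : set (n.-tuple T)) :
  measurable_fun setT p -> measurable_fun setT q ->
  (forall x, 2^-1 <= p x)%R -> (forall x, 2^-1 <= q x)%R ->
  \int[m]_x (p x)%:E = 1 -> \int[m]_x (q x)%:E = 1 ->
  \int[m]_x ((p x - q x) ^+ 2)%:E <= v%:E -> ((1 + 2 * v) ^+ n <= 5 / 4)%R ->
  measurable A -> measurable B -> A `|` B = setT ->
  (2^-1)%:E <= lik_mass p A + lik_mass q B.
Proof.
move=> mp mq p_ge q_ge p1 q1 pqv vn mA mB AB.
have p0 x : (0 < p x)%R by apply: lt_le_trans (p_ge x).
have q0 x : (0 < q x)%R by apply: lt_le_trans (q_ge x).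
pose w x := (p x ^+ 2 / q x)%R.
have w0 x : (0 <= w x)%R by rewrite divr_ge0 ?sqr_ge0// ltW.
have mqV : measurable_fun setT (fun x => (q x)^-1)%R.
  rewrite (_ : (fun _ => _) = (fun y : R => y `^ (-1))%R \o q).
    exact: measurableT_comp (measurable_powR _) mq.
  by apply/funext => x; rewrite /= powR_inv1// ltW.
have mw : measurable_fun setT w.
  by apply: measurable_funM => //; exact: measurable_funX.
have mpq : measurable_fun setT (fun x => (p x - q x) ^+ 2)%R.
  by apply: measurable_funX; exact: measurable_funB.
(* Pointwise [w + q = 2 p + (p - q)^2 / q], where [1 / q <= 2]. Keeping [q] on the left avoids a
   subtraction of integrals. *)
have w_le : \int[m]_x (w x)%:E + 1 <= 2%:E + 2%:E * v%:E.
  rewrite -[X in _ + X <= _]q1 -ge0_integralD//; last 4 first.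
  - by move=> x _; rewrite lee_fin.
  - exact/measurable_EFinP.
  - by move=> x _; rewrite lee_fin ltW.
  - exact/measurable_EFinP.
  apply: (@le_trans _ _ (\int[m]_x (2%:E * (p x)%:E + 2%:E * ((p x - q x) ^+ 2)%:E))).
    apply: ge0_le_integral => //.
    - by move=> x _; rewrite -EFinD lee_fin addr_ge0// ltW.
    - by apply: emeasurable_funD; exact/measurable_EFinP.
    - by apply: emeasurable_funD; apply: measurable_funeM; exact/measurable_EFinP.
    - move=> x _; rewrite -!EFinM -!EFinD lee_fin.
      have -> : (w x + q x = 2 * p x + (p x - q x) ^+ 2 / q x)%R.
        by rewrite /w; field; rewrite gt_eqF.
      rewrite lerD2l mulrC ler_wpM2r ?sqr_ge0//.
      by rewrite invf_ple// posrE.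
  rewrite ge0_integralD//; last 4 first.
  - by move=> x _; rewrite -EFinM lee_fin mulr_ge0// ltW.
  - by apply: measurable_funeM; exact/measurable_EFinP.
  - by move=> x _; rewrite -EFinM lee_fin mulr_ge0// sqr_ge0.
  - by apply: measurable_funeM; exact/measurable_EFinP.
  rewrite !ge0_integralZl//; last 4 first.
  - exact/measurable_EFinP.
  - by move=> x _; rewrite lee_fin sqr_ge0.
  - exact/measurable_EFinP.
  - by move=> x _; rewrite lee_fin ltW.
  by rewrite p1 mule1 leeD2l// lee_pmul2l.
have [W W0 [wW W_le]] : exists2 W : R, (0 <= W)%R &
    \int[m]_x (w x)%:E = W%:E /\ (W <= 1 + 2 * v)%R.
  have : 0 <= \int[m]_x (w x)%:E by apply: integral_ge0 => x _; rewrite lee_fin.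
  move: w_le; case: (integral _ _ _) => [W| |]//= + W0.
  rewrite -EFinM -!EFinD lee_fin => Wv; exists W; first by rewrite -lee_fin.
  by split=> //; lra.
have likW : \int[power_measure m n]_t (lik w t)%:E <= (5 / 4)%:E.
  rewrite (integral_lik n (c := W))// lee_fin.
  by apply: le_trans vn; rewrite lerXn2r// nnegrE// (le_trans W0).
have lik1 (r : T -> R) : measurable_fun setT r -> (forall x, 0 < r x)%R ->
    \int[m]_x (r x)%:E = 1 -> \int[power_measure m n]_t (lik r t)%:E = 1.
  move=> mr r0 r1; rewrite (integral_lik n (c := 1%R)) ?expr1n// => x.
  exact: ltW.
(* With [F] and [G] the likelihoods of [p] and [q], this follows on [A] from [F <= F^2 / G + G / 4]
   and on [B] from [2 F <= F^2 / G + G], both completed squares. Integration gives [2 <= lik_mass p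
   A + lik_mass q B + 5/4 + 1/4]. *)
have : \int[power_measure m n]_t (2%:E * (lik p t)%:E) <=
    \int[power_measure m n]_t ((\1_A t * lik p t)%:E + (\1_B t * lik q t)%:E
      + (lik w t)%:E + (4^-1)%:E * (lik q t)%:E).
  have mlik (r : T -> R) : measurable_fun setT r ->
      measurable_fun setT (fun t : n.-tuple T => (lik r t)%:E).
    by move=> mr; apply/measurable_EFinP; exact: measurable_lik.
  apply: ge0_le_integral => //.
  - by move=> t _; rewrite -EFinM lee_fin mulr_ge0// lik_ge0// => x; rewrite ltW.
  - by apply: measurable_funeM; exact: mlik.
  - apply: emeasurable_funD; last by apply: measurable_funeM; exact: mlik.
    apply: emeasurable_funD; last exact: mlik.
    by apply: emeasurable_funD; exact: measurable_indic_lik.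
  - move=> t _; rewrite -!EFinM -!EFinD lee_fin.
    have F0 : (0 < lik p t)%R by apply: prodr_gt0 => i _.
    have G0 : (0 < lik q t)%R by apply: prodr_gt0 => i _.
    have -> : lik w t = (lik p t ^+ 2 / lik q t)%R.
      by rewrite /lik -prodrXl -prodf_div.
    set F := lik p t in F0 *; set G := lik q t in G0 *.
    have key : (0 <= (F - G / 2) ^+ 2 / G)%R by rewrite divr_ge0 ?sqr_ge0// ltW.
    have key2 : (0 <= (F - G) ^+ 2 / G)%R by rewrite divr_ge0 ?sqr_ge0// ltW.
    have E1 : ((F - G / 2) ^+ 2 / G = F ^+ 2 / G - F + G / 4)%R.
      by field; rewrite gt_eqF.
    have E2 : ((F - G) ^+ 2 / G = F ^+ 2 / G - 2 * F + G)%R.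
      by field; rewrite gt_eqF.
    have : (A `|` B) t by rewrite AB.
    case=> [At|Bt]; rewrite !indicE.
      by rewrite mem_set// mul1r; case: (_ \in _); rewrite /=; lra.
    by rewrite (mem_set Bt) mul1r; case: (_ \in _); rewrite /=; lra.
have mlik (r : T -> R) : measurable_fun setT r ->
    measurable_fun setT (fun t : n.-tuple T => (lik r t)%:E).
  by move=> mr; apply/measurable_EFinP; exact: measurable_lik.
have p0' x : (0 <= p x)%R by rewrite ltW.
have q0' x : (0 <= q x)%R by rewrite ltW.
rewrite ge0_integralZl//; last 2 first.
- exact: mlik.
- by move=> t _; rewrite lee_fin lik_ge0.
rewrite (lik1 p)// mule1.
rewrite ge0_integralD//; last 4 first.
- by move=> t _; rewrite -!EFinD lee_fin !addr_ge0// ?mulr_ge0// lik_ge0.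
- apply: emeasurable_funD; last exact: mlik.
  by apply: emeasurable_funD; exact: measurable_indic_lik.
- by move=> t _; rewrite -EFinM lee_fin mulr_ge0// lik_ge0.
- by apply: measurable_funeM; exact: mlik.
rewrite ge0_integralD//; last 4 first.
- by move=> t _; rewrite -!EFinD lee_fin !addr_ge0// ?mulr_ge0// lik_ge0.
- by apply: emeasurable_funD; exact: measurable_indic_lik.
- by move=> t _; rewrite lee_fin lik_ge0.
- exact: mlik.
rewrite ge0_integralD//; last 4 first.
- by move=> t _; rewrite lee_fin mulr_ge0// lik_ge0.
- exact: measurable_indic_lik.
- by move=> t _; rewrite lee_fin mulr_ge0// lik_ge0.
- exact: measurable_indic_lik.
rewrite ge0_integralZl//; last 2 first.
- exact: mlik.
- by move=> t _; rewrite lee_fin lik_ge0.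
rewrite (lik1 q)// mule1 -/(lik_mass p A) -/(lik_mass q B).
move: likW (lik_mass p A + lik_mass q B).
case: (\int[_]_t (lik w t)%:E) => [y| |]// y_le [z| |]//.
- by move: y_le; rewrite -!EFinD !lee_fin; lra.
- by move=> _; exact: leey.
Qed.

Definition L1_error (q : T -> R) (phat : n.-tuple T -> T -> R) (t : n.-tuple T) :
    \bar R := \int[m]_x (`|q x - phat t x|)%:E.

Lemma measurable_integral_error (q : T -> R) (phat : n.-tuple T -> T -> R) (C : set T) :
  measurable_fun setT q ->
  measurable_fun setT (fun tx : n.-tuple T * T => phat tx.1 tx.2) ->
  measurable C ->
  measurable_fun setT
    (fun t => \int[m]_x (\1_C x * `|q x - phat t x|)%:E).
Proof.
move=> mq mphat mC.
apply: (measurable_fun_fubini_tonelli_F (m2 := m)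
  (fun tx : n.-tuple T * T => (\1_C tx.2 * `|q tx.2 - phat tx.1 tx.2|)%:E)) => //=.
  apply/measurable_EFinP; apply: measurable_funM.
    have mC1 : measurable_fun setT (\1_C : T -> R) by exact: measurable_indic.
    exact: (measurableT_comp mC1 measurable_snd).
  apply: measurableT_comp => //; apply: measurable_funB => //.
  exact: (measurableT_comp mq measurable_snd).
Qed.

Lemma L1_errorE q phat : L1_error q phat =
  fun t => \int[m]_x (\1_[set: T] x * `|q x - phat t x|)%:E.
Proof.
apply/funext => t; apply: eq_integral => x _.
by rewrite indicE in_setT mul1r.
Qed.

Lemma measurable_L1_error_gt q (phat : n.-tuple T -> T -> R) (s : R) :
  measurable_fun setT q ->
  measurable_fun setT (fun tx : n.-tuple T * T => phat tx.1 tx.2) ->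
  measurable [set t | s%:E < L1_error q phat t].
Proof.
move=> mq mphat; rewrite -[X in measurable X]setTI; apply: emeasurable_fun_o_infty => //.
by rewrite L1_errorE; exact: measurable_integral_error.
Qed.

(* If the estimate is within [s] of [p sigma], then for all but an eighth of the
   cells [C j] it is closer than [w] to [p sigma] on [C j], hence it distinguishes
   [p sigma] from [p (flip j sigma)] there; this is impossible for indistinguishable
   product laws. *)
Lemma assouad (J : finType) (p : {ffun J -> bool} -> T -> R) (C : J -> set T)
    (phat : n.-tuple T -> T -> R) (v w s : R) :
  measurable_fun setT (fun tx : n.-tuple T * T => phat tx.1 tx.2) ->
  (forall a, measurable_fun setT (p a)) -> (forall a x, 2^-1 <= p a x)%R ->
  (forall a, \int[m]_x (p a x)%:E = 1) ->
  (forall j, measurable (C j)) -> (forall i j x, C i x -> C j x -> i = j) ->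
  (0 < #|J|)%N -> (0 < w)%R ->
  (forall a j, (2 * w)%:E <= \int[m]_x (\1_(C j) x * `|p a x - p (flip j a) x|)%:E) ->
  (forall a j, \int[m]_x ((p a x - p (flip j a) x) ^+ 2)%:E <= v%:E) ->
  ((1 + 2 * v) ^+ n <= 5 / 4)%R -> (s <= w * #|J|%:R / 8)%R ->
  exists a, (8^-1)%:E <= lik_mass (p a) [set t | s%:E < L1_error (p a) phat t].
Proof.
move=> mphat mp p_ge p1 mC dC J0 w0 sep chi chin s_le.
have p0 a x : (0 <= p a x)%R by apply: le_trans (p_ge a x).
pose D a j t := \int[m]_x (\1_(C j) x * `|p a x - phat t x|)%:E.
have mD a j : measurable_fun setT (D a j) by exact: measurable_integral_error.
pose A a j := [set t | w%:E <= D a j t].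
have mA a j : measurable (A a j).
  by rewrite -[X in measurable X]setTI; exact: emeasurable_fun_c_infty.
have mpphat a t : measurable_fun setT (fun x => `|p a x - phat t x|)%R.
  apply: measurableT_comp => //; apply: measurable_funB => //.
  exact: (measurableT_comp mphat (measurable_pair1 t)).
have D_flip a j t : (2 * w)%:E <= D a j t + D (flip j a) j t.
  apply: le_trans (sep a j) _; rewrite -ge0_integralD//; last 2 first.
  - apply/measurable_EFinP; apply: measurable_funM => //.
  - apply/measurable_EFinP; apply: measurable_funM => //.
  apply: ge0_le_integral => //.
  - apply/measurable_EFinP; apply: measurable_funM => //.
    by apply: measurableT_comp => //; exact: measurable_funB.
  - apply: emeasurable_funD; apply/measurable_EFinP; apply: measurable_funM => //.
  - move=> x _; rewrite -EFinD lee_fin -mulrDr ler_wpM2l//.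
    by rewrite [X in (_ <= _ + X)%R]distrC ler_distD.
have A_flip a j : A a j `|` A (flip j a) j = setT.
  rewrite -subTset => t _; rewrite /A/=.
  have [|Dw] := leP w%:E (D a j t); first by left.
  have [|Dw'] := leP w%:E (D (flip j a) j t); first by right.
  have := D_flip a j t; rewrite leNgt.
  by rewrite (_ : 2 * w = w + w)%R ?EFinD ?lteD//; ring.
have fin a j : lik_mass (p a) (A a j) \is a fin_num by exact: lik_mass_fin_num.
(* By the two-point bound, the events of a bad estimate on cell [j] for [a] and for [flip j a] have
   total mass at least [1/2]; so for some [a] the expected number of bad cells is at least a quarter
   of all. *)
have [a Ha] : exists a, (2^-1 / 2 * #|J|%:R <=
    \sum_j fine (lik_mass (p a) (A a j)))%R.
  apply: exists_flip_average => a j.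
  rewrite -lee_fin EFinD !fineK//.
  exact: (lik_mass_two_point (v := v)).
exists a; set B := [set t | _].
have mB : measurable B by exact: measurable_L1_error_gt.
have sumC x : (\sum_j \1_(C j) x <= 1 :> R)%R.
  have [[j Cjx]|nC] := pselect (exists j, C j x).
    rewrite (bigD1 j)//= big1 ?addr0; first by rewrite indicE; case: (_ \in _).
    move=> i ij; rewrite indicE memNset//= => Cix.
    by move/eqP: ij; apply; exact: dC Cix Cjx.
  rewrite big1// => j _; rewrite indicE memNset//= => Cjx.
  by apply: nC; exists j.
have sumD t : \sum_j D a j t <= L1_error (p a) phat t.
  rewrite /D -ge0_integral_sum//; last first.
    by move=> j; apply/measurable_EFinP; exact: measurable_funM.
  apply: ge0_le_integral => //.
  - by move=> x _; apply: sume_ge0 => j _; rewrite lee_fin mulr_ge0.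
  - apply: emeasurable_sum => j; apply/measurable_EFinP; apply: measurable_funM => //.
  - exact/measurable_EFinP.
  - by move=> x _; rewrite sumEFin lee_fin -mulr_suml ler_piMl.
(* Outside [B] the total error is at most [s], so at most an eighth of the cells are bad; on [B] all
   may be. In expectation [|J| / 4 <= |J| / 8 + |J| b], with [b] the mass of [B], whence
   [b >= 1/8]. *)
have count t : (\sum_j \1_(A a j) t <= #|J|%:R / 8 + #|J|%:R * \1_B t :> R)%R.
  have [Bt|nBt] := pselect (B t).
    rewrite [\1_B t]indicE mem_set// mulr1.
    apply: (@le_trans _ _ (\sum_(j : J) 1)%R).
      by apply: ler_sum => j _; rewrite indicE; case: (_ \in _).
    by rewrite sumr_const lerDr divr_ge0.
  rewrite [\1_B t]indicE memNset// mulr0 addr0.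
  have : (\sum_j w * \1_(A a j) t)%:E <= s%:E.
    move/negP: nBt; rewrite -leNgt; apply: le_trans.
    apply: le_trans (sumD t); rewrite -sumEFin; apply: lee_sum => j _.
    rewrite indicE; have [|_] := boolP (t \in A a j).
      by rewrite inE mulr1.
    by rewrite mulr0; apply: integral_ge0 => x _; rewrite lee_fin mulr_ge0.
  rewrite lee_fin -mulr_sumr => /le_trans/(_ s_le).
  by rewrite -mulrA ler_pM2l.
have J0' : (0 < #|J|%:R :> R)%R by rewrite ltr0n.
have : \sum_j lik_mass (p a) (A a j) <=
    (#|J|%:R / 8)%:E + #|J|%:R%:E * lik_mass (p a) B.
  rewrite /lik_mass -ge0_integral_sum//; last 2 first.
  - by move=> j; exact: measurable_indic_lik.
  - by move=> j t _; rewrite lee_fin mulr_ge0// lik_ge0.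
  have lik1 : \int[power_measure m n]_t (lik (p a) t)%:E = 1.
    by rewrite (integral_lik n (c := 1%R))// expr1n.
  rewrite -[X in _ <= X + _]mule1 -{1}lik1.
  have mlik : measurable_fun setT (fun t : n.-tuple T => (lik (p a) t)%:E).
    by apply/measurable_EFinP; exact: measurable_lik.
  rewrite -ge0_integralZl//; last first.
    by move=> t _; rewrite lee_fin lik_ge0.
  rewrite -ge0_integralZl//; last 2 first.
  - exact: measurable_indic_lik.
  - by move=> t _; rewrite lee_fin mulr_ge0// lik_ge0.
  rewrite -ge0_integralD//; last 4 first.
  - by move=> t _; rewrite -EFinM lee_fin mulr_ge0 ?lik_ge0// divr_ge0.
  - exact: measurable_funeM.
  - by move=> t _; rewrite -EFinM lee_fin !mulr_ge0// lik_ge0.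
  - by apply: measurable_funeM; exact: measurable_indic_lik.
  apply: ge0_le_integral => //.
  - by move=> t _; apply: sume_ge0 => j _; rewrite lee_fin mulr_ge0// lik_ge0.
  - by apply: emeasurable_sum => j; exact: measurable_indic_lik.
  - apply: emeasurable_funD; apply: measurable_funeM => //.
    exact: measurable_indic_lik.
  - move=> t _; rewrite sumEFin -!EFinM -EFinD lee_fin -mulr_suml mulrA -mulrDl.
    by rewrite ler_wpM2r ?lik_ge0.
have -> : \sum_j lik_mass (p a) (A a j) = (\sum_j fine (lik_mass (p a) (A a j)))%:E.
  by rewrite -sumEFin; apply: eq_bigr => j _; rewrite fineK.
have : lik_mass (p a) B \is a fin_num by exact: lik_mass_fin_num.
case: (lik_mass (p a) B) => // b _; rewrite -EFinM -EFinD !lee_fin => Hb.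
have : (#|J|%:R * 8^-1 <= #|J|%:R * b)%R by lra.
by rewrite ler_pM2l.
Qed.

End assouad.

(** * Conditional independence *)

Section conditional_independence_theory.
Context {disp d1 d2 d3 : measure_display} {Omega : measurableType disp}.
Context {T1 : measurableType d1} {T2 : measurableType d2}.
Context {T3 : measurableType d3} {R : realType}.
Variable P : probability Omega R.
Local Open Scope ereal_scope.

Lemma cond_independentC (X : Omega -> T1) (Y : Omega -> T2) (Z : Omega -> T3) :
  cond_independent P X Y Z -> cond_independent P Y X Z.
Proof.
move=> XYZ S S' mS mS'; have [f [g [cf cg cfg]]] := XYZ S' S mS' mS.
exists g, f; split => //; rewrite setIC.
by under eq_fun do rewrite mulrC.
Qed.

Lemma finite_pushforward (m : {finite_measure set Omega -> \bar R}) (Z : Omega -> T3) :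
  measurable_fun setT Z ->
  exists m' : {finite_measure set T3 -> \bar R},
    m' = pushforward m Z :> (set T3 -> \bar R).
Proof.
move=> mZ.
pose m0 : {measure set T3 -> \bar R} :=
  measure_function_pushforward__canonical__measure_function_Measure m mZ.
have fin : fin_num_fun m0.
  move=> A mA; apply: fin_num_measure.
  by rewrite -[X in measurable X]setTI; exact (mZ measurableT A mA).
pose m1 := Measure_isFinite.Build _ _ _ m0 fin.
pose m2 : {finite_measure set T3 -> \bar R} := HB.pack (Measure.sort m0) m1.
by exists m2.
Qed.

(** The version is the Radon-Nikodym derivative, on [T3], of the image under [Z] of [P] restricted
    to [E] with respect to the law of [Z]. *)
Lemma exists_cond_prob (Z : Omega -> T3) (E : set Omega) :
  measurable_fun setT Z -> measurable E ->
  exists g : T3 -> R, is_cond_prob P Z E g.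
Proof.
move=> mZ mE.
have [nu nuE] := finite_pushforward (mrestr P mE) mZ.
have [mu muE] := finite_pushforward P mZ.
have numu : nu `<< mu.
  apply/null_content_dominatesP => A mA muA0.
  have PA0 : P (Z @^-1` A) = 0 by rewrite -[LHS]/(pushforward P Z A) -muE.
  suff : pushforward (mrestr P mE) Z A = 0 by rewrite -nuE.
  have mZA : measurable (Z @^-1` A).
    by rewrite -[X in measurable X]setTI; exact: mZ.
  apply/eqP; rewrite -measure_le0 -PA0.
  by apply: le_measure; rewrite ?inE//; exact: measurableI.
pose h := Radon_Nikodym_SigmaFinite.f nu mu.
have h0 := Radon_Nikodym_SigmaFinite.f_ge0 numu.
have hfin := Radon_Nikodym_SigmaFinite.f_fin_num numu.
have hE x : (fine (h x))%:E = h x by rewrite fineK.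
have mh : measurable_fun setT h.
  exact: measurable_int (Radon_Nikodym_SigmaFinite.f_integrable numu).
have hZ U : measurable U ->
    \int[P]_(w in Z @^-1` U) (fine (h (Z w)))%:E = P (E `&` Z @^-1` U).
  move=> mU; under eq_integral do rewrite hE.
  rewrite -[LHS](@ge0_integral_pushforward _ _ _ _ _ _ mZ P U h)//; last first.
    exact: measurable_funTS.
  rewrite -[pushforward P Z]/(pushforward P Z : set T3 -> \bar R) -muE.
  by rewrite -(Radon_Nikodym_SigmaFinite.f_integral numu)// nuE /pushforward/= /mrestr setIC.
have mfh : measurable_fun setT (fine \o h).
  by apply: measurableT_comp => //; exact: fine_measurable.
exists (fine \o h); split => //=.
- apply/integrableP; split.
    by apply/measurable_EFinP; exact: (measurableT_comp mfh mZ).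
  under eq_integral do rewrite gee0_abs ?lee_fin ?fine_ge0//.
  have := hZ setT measurableT; rewrite preimage_setT => ->.
  by rewrite ltey_eq fin_num_measure//; rewrite setIT.
Qed.

(** When [X] is independent of the pair [(Y, Z)], a constant is a version of the conditional
    probability of [X] given [Z], and multiplying by it any version for [Y] gives one for the
    intersection. *)
Lemma cond_independent_of_independent (X : Omega -> T1) (Y : Omega -> T2)
    (Z : Omega -> T3) :
  measurable_fun setT X -> measurable_fun setT Y -> measurable_fun setT Z ->
  (forall S S' U, measurable S -> measurable S' -> measurable U ->
    P (X @^-1` S `&` (Y @^-1` S' `&` Z @^-1` U)) =
    P (X @^-1` S) * P (Y @^-1` S' `&` Z @^-1` U)) ->
  cond_independent P X Y Z.
Proof.
move=> mX mY mZ indep S S' mS mS'.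
have pre d' (T' : measurableType d') (W : Omega -> T') V :
    measurable_fun setT W -> measurable V -> measurable (W @^-1` V).
  by move=> mW mV; rewrite -[X in measurable X]setTI; exact: mW.
have mXS := pre _ _ _ _ mX mS; have mYS := pre _ _ _ _ mY mS'.
have [g cg] := exists_cond_prob mZ mYS.
pose c := fine (P (X @^-1` S)).
have cE : c%:E = P (X @^-1` S) by rewrite fineK// fin_num_measure.
have [mg ig gE] := cg.
exists (cst c), g; split => //.
- split => //; first exact: finite_measure_integrable_cst.
  move=> U mU.
  rewrite (_ : (fun w => (cst c (Z w))%:E) = cst c%:E)//.
  rewrite (integral_cst P (pre _ _ _ _ mZ mU)).
  by rewrite cE -[Z @^-1` U]setTI -{1}(preimage_setT Y) -indep// preimage_setT setTI.
- split => //.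
  + exact: measurable_funM.
  + by under eq_fun do rewrite EFinM; exact: integrableZl.
  + move=> U mU; under eq_integral do rewrite EFinM.
    rewrite integralZl//; [|exact: pre|apply: (integrableS measurableT) => //; exact: pre].
    by rewrite gE// cE -indep// setIA.
Qed.

End conditional_independence_theory.

(** * Densities on the unit cube and the Markov property *)

Section uniform_cube.
Variable R : realType.
Local Open Scope ereal_scope.

Definition uniform01 : {sigma_finite_measure set (measurableTypeR R) -> \bar R} :=
  uniform_prob (@ltr01 R).

Lemma integral_uniform01 (f : R -> \bar R) :
  measurable_fun setT f -> (forall x, 0 <= f x) ->
  \int[uniform01]_x f x = \int[lebesgue_measure]_(x in `[0%R, 1%R]) f x.
Proof.
by move=> mf f0; rewrite integral_uniform// subr0 invr1 mul1e.
Qed.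

Lemma uniform01T : uniform01 setT = 1.
Proof. exact: probability_setT. Qed.

(** The base measure of all that follows. Having mass one, it makes coordinates independent, and
    densities become functions on the whole space with no restriction to the cube. *)
Definition uniform_cube (d : nat) : set (Rd R d) -> \bar R := power_measure uniform01 d.

HB.instance Definition _ (d : nat) := SigmaFiniteMeasure.on (@uniform_cube d).
Arguments uniform_cube : clear implicits.

Lemma integral_unit_cube d (f : Rd R d -> \bar R) :
  measurable_fun setT f -> (forall x, 0 <= f x) ->
  \int[@lebesgue_Rd R d]_(x in @unit_cube R d) f x = \int[uniform_cube d]_x f x.
Proof.
move=> mf f0; rewrite integral_mkcond /lebesgue_Rd /uniform_cube.
elim: d f mf f0 => [|d IH] f mf f0.
  rewrite !ge0_integral_power0//; last by move=> t; exact: erestrict_ge0.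
  by rewrite patchE mem_set// => -[].
have mcube k := @measurable_unit_cube R k.
have mfx x : measurable_fun setT (fun t : Rd R d => f [tuple of x :: t]).
  by apply: (measurableT_comp mf); exact: measurable_cons_section.
rewrite !ge0_integral_powerS//; last 2 first.
- by apply/(measurable_restrictT _ (mcube _)); exact: measurable_funTS.
- by move=> t; exact: erestrict_ge0.
rewrite integral_uniform01; last 2 first.
- exact: (@measurable_integral_cons _ (measurableTypeR R) R uniform01 d f mf f0).
- by move=> x; exact: integral_ge0.
rewrite [RHS]integral_mkcond; apply: eq_integral => x _.
rewrite patchE; case: ifPn => [|]; last first.
  move=> xI; apply: integral0_eq => t _; rewrite patchE memNset// => /(_ ord0).
  by rewrite tnth0 => x01; move/negP : xI; apply; rewrite inE/= in_itv/=.
rewrite inE/= in_itv/= => x01; rewrite -IH//.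
apply: eq_integral => t _; rewrite !patchE.
have -> : ([tuple of x :: t] \in @unit_cube R d.+1) = (t \in @unit_cube R d).
  apply/idP/idP; rewrite !inE => tI i.
    by have := tI (lift ord0 i); rewrite tnthS.
  by case: (unliftP ord0 i) => [j ->|->]; rewrite ?tnthS ?tnth0.
by [].
Qed.

Section density_of_function.
Variables (d : nat) (q : Rd R d -> R).
Hypotheses (mq : measurable_fun setT q) (q0 : forall x, (0 <= q x)%R)
  (q1 : \int[uniform_cube d]_x (q x)%:E = 1).

Let q_int : \int[@lebesgue_Rd R d]_(x in @unit_cube R d) (q x)%:E = 1.
Proof.
by rewrite integral_unit_cube//; exact/measurable_EFinP.
Qed.

Definition density_of : density R d :=
  @Density R d q (measurable_funTS mq) (fun x _ => q0 x) q_int.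

Lemma density_law_of (A : set (Rd R d)) : measurable A ->
  density_law density_of A = \int[uniform_cube d]_(x in A) (q x)%:E.
Proof.
move=> mA; rewrite /density_law/= integral_mkcondl integral_unit_cube.
- by rewrite [RHS]integral_mkcond.
- by apply/(measurable_restrictT _ mA)/measurable_funTS/measurable_EFinP.
- by move=> x; apply: erestrict_ge0 => y _; rewrite lee_fin.
Qed.

Lemma power_density_law n (A : set (n.-tuple (Rd R d))) : measurable A ->
  power_measure (density_law density_of) n A = lik_mass (uniform_cube d) q A.
Proof.
move=> mA.
have -> : power_measure (density_law density_of) n A =
    \int[power_measure (density_law density_of) n]_t (\1_A t)%:E.
  by rewrite integral_indic// setIT.
rewrite (@ge0_integral_power_density _ _ _ (uniform_cube d) (density_law density_of) q)//.
- by move=> B mB; exact: density_law_of.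
- by apply/measurable_EFinP; exact: measurable_indic.
Qed.

Lemma L1_dist_of n (phat : n.-tuple (Rd R d) -> Rd R d -> R) t :
  measurable_fun setT (fun tx : n.-tuple (Rd R d) * Rd R d => phat tx.1 tx.2) ->
  L1_dist density_of (phat t) = L1_error (uniform_cube d) q phat t.
Proof.
move=> mphat; rewrite /L1_dist /L1_error integral_unit_cube//.
apply/measurable_EFinP/measurableT_comp => //; apply: measurable_funB => //.
exact: (measurableT_comp mphat (measurable_pair1 t)).
Qed.

End density_of_function.

Lemma depends_on_subvector d (A : {set 'I_d}) (B : pred 'I_d) (S : set (Rd R #|A|)) :
  (forall i, i \in A -> B i) ->
  depends_on B (fun x : Rd R d => \1_(@subvector R d A @^-1` S) x : R).
Proof.
move=> AB s t st; rewrite !indicE.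
have E : subvector A s = subvector A t.
  by apply: eq_from_tnth => i; rewrite !tnth_mktuple st// AB// enum_valP.
by congr ((nat_of_bool _)%:R); apply/idP/idP; rewrite !inE/= E.
Qed.

Lemma measurable_subvector d (A : {set 'I_d}) :
  measurable_fun setT (@subvector R d A).
Proof.
apply/measurable_fun_tnthP => i.
rewrite (_ : _ \o _ = fun x : Rd R d => tnth x (enum_val i)).
  exact: measurable_tnth.
by apply/funext => x /=; rewrite tnth_mktuple.
Qed.

(** Since [q] ignores the coordinates in [A], the indicator of an event on [A] depends on [A] alone,
    while [q] times an event on [B] and [C] depends on the complement: the integral factors under
    the uniform law. *)
Lemma cond_independent_of_disjoint d (q : Rd R d -> R) mq q0 q1
    (K A B C : {set 'I_d}) :
  depends_on (mem K) q ->
  [disjoint A & B]%B -> [disjoint A & C]%B -> [disjoint A & K]%B ->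
  cond_independent (density_law (@density_of d q mq q0 q1))
    (@subvector R d A) (@subvector R d B) (@subvector R d C).
Proof.
move=> Kq AB AC AK.
apply: cond_independent_of_independent; try exact: measurable_subvector.
move=> S S' U mS mS' mU.
have pre (D : {set 'I_d}) V : measurable V -> measurable (@subvector R d D @^-1` V).
  move=> mV; rewrite -[X in measurable X]setTI.
  exact: measurable_subvector.
have mXS := pre _ _ mS; have mYZ := measurableI _ _ (pre _ _ mS') (pre _ _ mU).
set XS := @subvector R d A @^-1` S; set YZ := _ `&` _ in mYZ *.
have notin (D : {set 'I_d}) i : [disjoint A & D]%B -> i \in D -> i \notin A.
  by move=> AD iD; apply: contraTN iD => iA; apply/negbT/(disjointFr AD iA).
have qE D : measurable D -> \int[uniform_cube d]_(x in D) (q x)%:E =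
    \int[uniform_cube d]_x (((\1_D x)%:E) * (q x)%:E).
  move=> mD; rewrite integral_mkcond; apply: eq_integral => x _.
  by rewrite patchE indicE; case: (_ \in _); rewrite ?mul1e ?mul0e.
pose p := density_of mq q0 q1.
change (density_law p (XS `&` YZ) = density_law p XS * density_law p YZ).
rewrite !density_law_of//; last exact: measurableI.
rewrite !qE//; last exact: measurableI.
have mind D : measurable D -> measurable_fun setT (fun x : Rd R d => (\1_D x : R)%:E).
  by move=> mD; apply/measurable_EFinP; exact: measurable_indic.
have mqE : measurable_fun setT (fun x => (q x)%:E) by exact/measurable_EFinP.
have XSA : depends_on (mem A) (fun x : Rd R d => (\1_XS x : R)%:E).
  by move=> s t st; rewrite (@depends_on_subvector d A (mem A) S (fun i h => h) s t).
have YZA : depends_on (predC (mem A)) (fun x : Rd R d => ((\1_YZ x : R)%:E * (q x)%:E)).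
  move=> s t st; rewrite !indicI/=.
  rewrite (Kq s t); last by move=> i Ki; apply: st; exact: notin AK Ki.
  rewrite (@depends_on_subvector d B (predC (mem A)) S' (fun i => notin B i AB) s t)//.
  by rewrite (@depends_on_subvector d C (predC (mem A)) U (fun i => notin C i AC) s t).
have qA : depends_on (predC (mem A)) (fun x : Rd R d => (q x)%:E).
  by move=> s t st; rewrite (Kq s t)// => i Ki; apply: st; exact: notin AK Ki.
under eq_integral do rewrite indicI EFinM -muleA.
rewrite (@ge0_integral_power_indep _ _ _ uniform01 d (mem A)) ?uniform01T//; last 3 first.
- exact: mind.
- by apply: emeasurable_funM => //; exact: mind.
- by move=> t; rewrite mule_ge0// lee_fin.
rewrite [X in _ = X * _](@ge0_integral_power_indep _ _ _ uniform01 d (mem A)) ?uniform01T//; last exact: mind.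
(* The total mass of [q] is the only trace that it leaves in the law of the block [A]. *)
by rewrite [X in _ = _ * X * _]q1 mule1.
Qed.

(** If [A] and [B] both met [K], a vertex of one would be adjacent to a vertex of the other, and
    this single edge would be a path avoiding [C]. *)
Lemma markov_of_clique d (e : rel 'I_d) (K : {set 'I_d}) (q : Rd R d -> R) mq q0 q1 :
  clique e K -> depends_on (mem K) q ->
  markov_property e (@density_of d q mq q0 q1).
Proof.
move=> /forall_inP Ke Kq A B C AB AC BC sep.
have [AK|] := boolP [disjoint A & K]%B.
  exact: cond_independent_of_disjoint Kq AB AC AK.
move=> /pred0Pn[a /andP[/= aA aK]].
apply/cond_independentC/(cond_independent_of_disjoint _ _ _ Kq) => //.
  by rewrite disjoint_sym.
apply/pred0P => b /=; apply/negP => /andP[bB bK].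
have ab : a != b.
  by apply: contraTneq bB => <-; rewrite (disjointFr AB).
have /forall_inP/(_ b bK)/implyP/(_ ab) eab := Ke a aK.
have [|c] := sep a [:: b] aA _ bB; first by rewrite /= eab.
rewrite !inE => /orP[/eqP->|/eqP->] cC.
  by rewrite (disjointFr AC) in cC.
by rewrite (disjointFr BC) in cC.
Qed.

End uniform_cube.

Arguments uniform_cube : clear implicits.

(** * A mean-zero bump on the line *)

Section bump.
Variable R : realType.
Implicit Types u v x : R.

(** Half the derivative of [(u (1 - u))^2]: it vanishes at both ends of the unit interval and has
    mean zero there. *)
Definition bump_poly u : R := u * (1 - u) * (1 - 2 * u).

(** Clipping the argument extends the polynomial by zero, and being a contraction it preserves the
    Lipschitz constant. *)
Definition bump u : R := bump_poly (Num.max 0 (Num.min 1 u)).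

Lemma clip01P u : 0 <= Num.max 0 (Num.min 1 u) <= 1.
Proof. by rewrite le_max lexx ge_max ler01 ge_min lexx. Qed.

Lemma bumpE u : 0 <= u <= 1 -> bump u = bump_poly u.
Proof. by case/andP => u0 u1; rewrite /bump min_r// max_r. Qed.

Lemma bump_out u : ~~ (0 < u < 1) -> bump u = 0.
Proof.
rewrite negb_and -!leNgt => /orP[u0|u1].
  by rewrite /bump min_r ?(le_trans u0)// max_l// /bump_poly !mul0r.
by rewrite /bump min_l// max_r// /bump_poly subrr mulr0 mul0r.
Qed.

Lemma bump_lipschitz u v : `|bump u - bump v| <= `|u - v|.
Proof.
rewrite /bump; set a := Num.max 0 (Num.min 1 u); set b := Num.max 0 (Num.min 1 v).
have /andP[a0 a1] := clip01P u; have /andP[b0 b1] := clip01P v.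
rewrite -/a -/b in a0 a1 b0 b1.
have clip_le : `|a - b| <= `|u - v|.
  have uv := ler_norm (u - v); have vu := ler_norm (v - u); rewrite distrC in vu.
  rewrite /a /b; case: (leP 1 u) => ?; case: (leP 1 v) => ?;
  do !(case: (leP 0 _) => ?); rewrite ler_norml; apply/andP; split; lra.
apply: le_trans clip_le.
(* The second factor equals [3/2 (a + b - 1)^2 + 1/2 (a - b)^2 - 1/2], hence is at least [- 1/2]; on
   the unit square it is at most one. *)
have -> : bump_poly a - bump_poly b =
    (a - b) * (1 - 3 * (a + b) + 2 * (a ^+ 2 + a * b + b ^+ 2)).
  by rewrite /bump_poly; ring.
rewrite normrM ler_piMr// ler_norml; apply/andP; split; last by nra.
by have := sqr_ge0 (a + b - 1); have := sqr_ge0 (a - b); nra.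
Qed.

Lemma bump_le1 u : `|bump u| <= 1.
Proof.
have /andP[] := clip01P u; rewrite /bump /bump_poly; set a := Num.max _ _ => a0 a1.
by rewrite !normrM !mulr_ile1// ?mulr_ge0// ?normr_ge0// ler_norml; apply/andP; split; lra.
Qed.

Lemma bump_ge u : 8^-1 <= u <= 3 / 8 -> 5 / 256 <= bump u.
Proof.
move=> /andP[u0 u1]; rewrite bumpE; last by apply/andP; split; lra.
rewrite /bump_poly.
have -> : 5 / 256 = 8^-1 * (5 / 8) * (4^-1) :> R by field.
by rewrite !ler_pM// ?mulr_ge0//; lra.
Qed.

Lemma measurable_bump : measurable_fun setT bump.
Proof.
apply: (@measurableT_comp _ _ _ _ _ _ bump_poly).
  apply: measurable_funM; first by apply: measurable_funM => //; exact: measurable_funB.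
  by apply: measurable_funB => //; exact: measurable_funM.
by apply: measurable_maxr => //; exact: measurable_minr.
Qed.

Section grid.
Variables (N a : nat).
Hypotheses (N0 : (0 < N)%N) (aN : (a < N)%N).

Definition grid_bump x : R := bump (N%:R * x - a%:R).

Definition grid_cell : set R := [set x | 0 < N%:R * x - a%:R < 1].

Let NR : 0 < N%:R :> R. Proof. by rewrite ltr0n. Qed.

Lemma measurable_grid_bump : measurable_fun setT grid_bump.
Proof.
apply: (measurableT_comp measurable_bump).
by apply: measurable_funB => //; exact: measurable_funM.
Qed.

Lemma grid_bump_lipschitz x y : `|grid_bump x - grid_bump y| <= N%:R * `|x - y|.
Proof.
apply: le_trans (bump_lipschitz _ _) _.
rewrite (_ : _ - _ = N%:R * (x - y)); last by ring.
by rewrite normrM ger0_norm// ltW.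
Qed.

Lemma grid_bump_out x : ~ grid_cell x -> grid_bump x = 0.
Proof. by move=> /negP; exact: bump_out. Qed.

Lemma uniform01_grid (u v : R) : 0 <= u -> u < v -> v <= 1 ->
  uniform01 R [set x : R | u < N%:R * x - a%:R < v] = ((v - u) / N%:R)%:E.
Proof.
move=> u0 uv v1.
have -> : [set x : R | u < N%:R * x - a%:R < v] =
    `](a%:R + u) / N%:R, (a%:R + v) / N%:R[%classic.
  apply/seteqP; split => x /=; rewrite in_itv/= ltr_pdivrMr// ltr_pdivlMr//;
    move=> /andP[? ?]; apply/andP; split; lra.
have aN' : a%:R + 1 <= N%:R :> R by rewrite natr1 ler_nat.
have a0 : 0 <= a%:R :> R by [].
set I := [set` _]; have mI : measurable I by exact: measurable_itv.
have -> : uniform01 R I = (\int[uniform01 R]_x (\1_I x)%:E)%E.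
  by rewrite integral_indic// setIT.
rewrite integral_uniform01//; last by apply/measurable_EFinP; exact: measurable_indic.
rewrite integral_indic// setIidl; last first.
  move=> x; rewrite /I/= !in_itv/= ltr_pdivrMr// ltr_pdivlMr// => /andP[? ?].
  by apply/andP; split; nra.
rewrite /I [LHS]lebesgue_measure_itv/= lte_fin ltr_pM2r ?invr_gt0// ltrD2l uv.
by rewrite -EFinB -mulrBl; congr (_ * _)%:E; ring.
Qed.

Lemma measurable_grid (u v : R) :
  measurable [set x : R | u < N%:R * x - a%:R < v].
Proof.
have -> : [set x : R | u < N%:R * x - a%:R < v] =
    `](a%:R + u) / N%:R, (a%:R + v) / N%:R[%classic.
  apply/seteqP; split => x /=; rewrite in_itv/= ltr_pdivrMr// ltr_pdivlMr//;
    move=> /andP[? ?]; apply/andP; split; lra.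
exact: measurable_itv.
Qed.

Local Open Scope ereal_scope.

Lemma lebesgue_integral_grid_bump :
  \int[lebesgue_measure]_(x in `[0%R, 1%R]) (grid_bump x)%:E = 0.
Proof.
have aN' : (a%:R + 1 <= N%:R :> R)%R by rewrite natr1 ler_nat.
have a0 : (0 <= a%:R :> R)%R by [].
pose l := (a%:R / N%:R)%R : R; pose r := ((a%:R + 1) / N%:R)%R : R.
have lr : (l < r)%R by rewrite ltr_pM2r ?invr_gt0// ltrDl.
have cellI : `[l, r]%classic `<=` (`[0%R, 1%R]%classic : set R).
  move=> x/=; rewrite !in_itv/= ler_pdivrMr// ler_pdivlMr// => /andP[? ?].
  by apply/andP; split; nra.
have -> : (fun x => (grid_bump x)%:E) = (fun x => (grid_bump x)%:E) \_ `[l, r].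
  apply/funext => x; rewrite patchE; case: ifPn => //.
  rewrite notin_setE/= in_itv/= => xlr; rewrite grid_bump_out// /grid_cell/= => xc.
  apply: xlr; rewrite ler_pdivrMr// ler_pdivlMr//.
  by move: xc => /andP[? ?]; apply/andP; split; lra.
rewrite -integral_mkcondr setIidr//.
have [u [uE du]] : exists u : {poly R},
    (forall x, u.[x] = N%:R * x - a%:R)%R /\ (u^`() = N%:R%:P)%R.
  exists (N%:R *: 'X - a%:R%:P)%R; split; first by move=> x; rewrite !hornerE.
  by rewrite derivB derivZ derivX derivC subr0 alg_polyC.
(* A primitive of the bump on its cell, zero at both endpoints. *)
pose P : {poly R} := ((2 * N%:R)^-1 *: (u * u * ((1 - u) * (1 - u))))%R.
have PE x : (P^`()).[x]%R = bump_poly (N%:R * x - a%:R)%R.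
  rewrite /P derivZ !derivM derivB du derivC sub0r.
  rewrite !(hornerZ, hornerD, hornerM, hornerN, hornerC) !uE /bump_poly/=.
  by field; rewrite gt_eqF.
transitivity (\int[lebesgue_measure]_(x in `[l, r]) ((P^`()).[x])%:E).
  apply: eq_integral => x; rewrite inE/= in_itv/= ler_pdivrMr// ler_pdivlMr// => /andP[? ?].
  by rewrite PE /grid_bump bumpE//; apply/andP; split; lra.
rewrite (@continuous_FTC2 _ _ (horner P))//.
- rewrite /P !(hornerZ, hornerM, hornerD, hornerN, hornerC) !uE.
  have -> : (N%:R * r - a%:R = 1)%R by rewrite /r; field; rewrite gt_eqF.
  have -> : (N%:R * l - a%:R = 0)%R by rewrite /l; field; rewrite gt_eqF.
  by rewrite -EFinB; congr (_%:E); ring.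
- by apply: continuous_subspaceT; exact: continuous_horner.
- split; first by move=> x _; exact: derivable_horner.
    by apply: cvg_at_right_filter; exact: continuous_horner.
  by apply: cvg_at_left_filter; exact: continuous_horner.
- by move=> x _; rewrite derivE.
Qed.

(** Mean zero, restated as equality of the integrals of the positive and negative parts, so that
    products of bumps can be integrated by a formula for nonnegative factors. The common value [c]
    is never computed. *)
Lemma integral_grid_bump_parts :
  exists c : R, [/\ \int[uniform01 R]_x (Num.max (grid_bump x) 0)%:E = c%:E,
    \int[uniform01 R]_x (Num.max (- grid_bump x)%R 0)%:E = c%:E &
    \int[uniform01 R]_x (`|grid_bump x|)%:E = (c + c)%:E].
Proof.
pose f x := (grid_bump x)%:E.
have mf : measurable_fun setT f by apply/measurable_EFinP; exact: measurable_grid_bump.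
have fpE : (fun x => (Num.max (grid_bump x) 0)%:E) = f^\+.
  by apply/funext => x; rewrite funeposE /f EFin_max.
have fnE : (fun x => (Num.max (- grid_bump x)%R 0)%:E) = f^\-.
  by apply/funext => x; rewrite funenegE /f EFin_max.
have le1 g : measurable_fun setT g -> (forall x, 0 <= g x <= 1) ->
    \int[uniform01 R]_x g x \is a fin_num.
  move=> mg g01; rewrite ge0_fin_numE; last first.
    by apply: integral_ge0 => x _; case/andP: (g01 x).
  apply: (@le_lt_trans _ _ (\int[uniform01 R]_x cst 1 x)).
    by apply: ge0_le_integral => // x _; case/andP: (g01 x).
  rewrite (integral_cst (uniform01 R) measurableT) mul1e.
  by rewrite [ltLHS](uniform01T R) ltry.
have fp1 : \int[uniform01 R]_x f^\+ x \is a fin_num.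
  apply: le1; first exact: measurable_funepos.
  move=> x; rewrite funepos_ge0/= -fpE lee_fin ge_max ler01 andbT.
  exact: le_trans (ler_norm _) (bump_le1 _).
have fn1 : \int[uniform01 R]_x f^\- x \is a fin_num.
  apply: le1; first exact: measurable_funeneg.
  move=> x; rewrite funeneg_ge0/= -fnE lee_fin ge_max ler01 andbT.
  by rewrite (le_trans (ler_norm _))// normrN bump_le1.
have E : \int[uniform01 R]_x f^\+ x - \int[uniform01 R]_x f^\- x = 0.
  rewrite !integral_uniform01//; [|exact: measurable_funeneg|exact: measurable_funepos].
  by rewrite -integralE lebesgue_integral_grid_bump.
have EE : \int[uniform01 R]_x f^\- x = \int[uniform01 R]_x f^\+ x.
  move: E; rewrite -(fineK fp1) -(fineK fn1) -EFinB => -[] E.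
  by congr (_%:E); lra.
exists (fine (\int[uniform01 R]_x f^\+ x)); rewrite fpE fnE EFinD fineK//; split => //.
rewrite -{2}EE -ge0_integralD//; [|exact: measurable_funepos|exact: measurable_funeneg].
apply: eq_integral => x _; rewrite -fpE -fnE -EFinD; congr (_%:E).
have [b0|/ltW b0] := leP 0%R (grid_bump x).
  by rewrite ger0_norm// max_r ?oppr_le0// addr0.
by rewrite ler0_norm// max_l ?oppr_ge0// add0r.
Qed.

End grid.
End bump.

(** * Sums of functions supported on disjoint cells *)

Section cell_sum.
Context {T : Type} {R : realFieldType} {J : finType}.
Variables (C : J -> set T) (phi : J -> T -> R).
Hypotheses (dC : forall i j x, C i x -> C j x -> i = j)
  (phi_out : forall j x, ~ C j x -> phi j x = 0).
Implicit Types (s : {ffun J -> bool}) (x y : T).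

Definition cell_sum s x : R := \sum_j (-1) ^+ s j * phi j x.

Lemma cell_sumE s j x : C j x -> cell_sum s x = (-1) ^+ s j * phi j x.
Proof.
move=> Cjx; rewrite /cell_sum (bigD1 j)//= big1 ?addr0// => i ij.
rewrite phi_out ?mulr0// => Cix.
by move/eqP: ij; apply; exact: dC Cix Cjx.
Qed.

Lemma cell_sum_out s x : (forall j, ~ C j x) -> cell_sum s x = 0.
Proof.
by move=> nC; rewrite /cell_sum big1// => j _; rewrite phi_out ?mulr0.
Qed.

Lemma cell_sum_le s x (b : R) : 0 <= b -> (forall j, `|phi j x| <= b) ->
  `|cell_sum s x| <= b.
Proof.
move=> b0 phib; have [[j Cjx]|nC] := pselect (exists j, C j x).
  by rewrite (cell_sumE _ Cjx) normrM normr_sign mul1r.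
by rewrite cell_sum_out ?normr0// => j Cjx; apply: nC; exists j.
Qed.

(** The factor 2 covers points in no common cell: the bump of the cell of [x] vanishes at [y] and
    conversely, so each value is itself a difference of at most [l]. No crossing of cell boundaries
    has to be followed. *)
Lemma cell_sum_dist s x y (l : R) : 0 <= l ->
  (forall j, `|phi j x - phi j y| <= l) ->
  `|cell_sum s x - cell_sum s y| <= 2 * l.
Proof.
move=> l0 phil.
have [[j [Cjx Cjy]]|nC] := pselect (exists j, C j x /\ C j y).
  rewrite (cell_sumE _ Cjx) (cell_sumE _ Cjy) -mulrBr normrM normr_sign mul1r.
  by apply: le_trans (phil j) _; lra.
have small z z' : (forall j, C j z -> ~ C j z') ->
    (forall j, `|phi j z - phi j z'| <= l) -> `|cell_sum s z| <= l.
  move=> nCzz' phil'; have [[j Cjz]|nCz] := pselect (exists j, C j z).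
    rewrite (cell_sumE _ Cjz) normrM normr_sign mul1r.
    by have := phil' j; rewrite (phi_out (nCzz' _ Cjz)) subr0.
  by rewrite cell_sum_out ?normr0// => j Cjz; apply: nCz; exists j.
rewrite (_ : 2 * l = l + l); last by ring.
apply: le_trans (ler_normB _ _) _; apply: lerD.
  by apply: (small _ y) => // j Cjx Cjy; apply: nC; exists j.
apply: (small _ x) => [j Cjy Cjx|j]; first by apply: nC; exists j.
by rewrite distrC.
Qed.

Lemma cell_sum_flip s j x :
  cell_sum s x - cell_sum (flip j s) x = 2 * (-1) ^+ s j * phi j x.
Proof.
rewrite /cell_sum (bigD1 j)//= [X in _ - X](bigD1 j)//= ffunE eqxx.
rewrite [X in _ - (_ + X)](_ : _ = \sum_(i | i != j) (-1) ^+ s i * phi i x).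
  by rewrite signrN; ring.
by apply: eq_bigr => i ij; rewrite ffunE (negbTE ij).
Qed.

End cell_sum.

(** Factors are exchanged one at a time; the bounds on both partial products are carried through the
    induction. *)
Lemma ler_norm_prodB (R : realFieldType) (I : finType) (a b : I -> R) :
  (forall i, `|a i| <= 1) -> (forall i, `|b i| <= 1) ->
  `|\prod_i a i - \prod_i b i| <= \sum_i `|a i - b i|.
Proof.
move=> a1 b1.
suff [] : [/\ `|\prod_i a i - \prod_i b i| <= \sum_i `|a i - b i|,
    `|\prod_i a i| <= 1 & `|\prod_i b i| <= 1] by [].
apply: (big_ind3 (fun x y z : R => [/\ `|x - y| <= z, `|x| <= 1 & `|y| <= 1])).
- by rewrite subrr normr0 normr1.
- move=> x1 y1 z1 x2 y2 z2 [xy1 x11 y11] [xy2 x21 y21]; split.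
  + rewrite (_ : x1 * x2 - y1 * y2 = (x1 - y1) * x2 + y1 * (x2 - y2)); last by ring.
    apply: le_trans (ler_normD _ _) _; rewrite !normrM lerD//.
      by rewrite (le_trans _ xy1)// ler_piMr.
    by rewrite (le_trans _ xy2)// ler_piMl.
  + by rewrite normrM mulr_ile1.
  + by rewrite normrM mulr_ile1.
- by move=> i _; split.
Qed.

Lemma expr1D_le (R : realFieldType) (x : R) n : 0 <= x -> n%:R * x <= 5^-1 ->
  (1 + x) ^+ n <= 5 / 4.
Proof.
move=> x0 nx.
(* For [k = n] the second factor is at least [4/5]. *)
have H k : (1 + x) ^+ k * (1 - k%:R * x) <= 1.
  elim: k => [|k IH]; first by rewrite expr0 mul0r subr0 mulr1.
  apply: le_trans IH; rewrite exprSr -mulrA ler_wpM2l ?exprn_ge0 ?addr_ge0//.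
  have k0 : 0 <= k%:R :> R by [].
  by rewrite -natr1; nra.
have P0 : 0 <= (1 + x) ^+ n by rewrite exprn_ge0 ?addr_ge0.
by have := H n; nra.
Qed.

(** * Product bumps *)

Section product_bump.
Variables (R : realType) (d : nat) (K : {set 'I_d}) (i0 : 'I_d) (N' : nat).
Hypothesis i0K : i0 \in K.
Local Notation N := N'.+1.
Implicit Types (x y : Rd R d) (j : {ffun 'I_d -> 'I_N}).

(* A sign-changing bump in the coordinate [i0] only: the positive and the negative
   part of the product are then products of nonnegative functions. *)
Definition bump_factor (i : 'I_d) (a : nat) (u : R) : R :=
  if i \in K then if i == i0 then grid_bump N a u else `|grid_bump N a u| else 1.

Definition bump_factor_part (s : bool) (i : 'I_d) (a : nat) (u : R) : R :=
  if i == i0 then Num.max ((-1) ^+ s * grid_bump N a u) 0 else bump_factor i a u.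

Definition product_bump j x : R := \prod_i bump_factor i (j i) (tnth x i).

Definition product_bump_part s j x : R :=
  \prod_i bump_factor_part s i (j i) (tnth x i).

Definition product_cell j : set (Rd R d) :=
  [set x | forall i, i \in K -> grid_cell N (j i) (tnth x i)].

Lemma product_bumpE j x :
  product_bump j x = product_bump_part false j x - product_bump_part true j x.
Proof.
rewrite /product_bump /product_bump_part (bigD1 i0)//= [X in _ = X - _](bigD1 i0)//=.
rewrite [X in _ = _ - X](bigD1 i0)//=.
have E s : \prod_(i < d | i != i0) bump_factor_part s i (j i) (tnth x i) =
    \prod_(i < d | i != i0) bump_factor i (j i) (tnth x i).
  by apply: eq_bigr => i ii0; rewrite /bump_factor_part (negbTE ii0).
rewrite !E -mulrBl; congr (_ * _).
rewrite /bump_factor_part /bump_factor eqxx i0K expr0 expr1 mul1r mulN1r.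
set b := grid_bump _ _ _; have [b0|/ltW b0] := leP 0 b.
  by rewrite max_r ?oppr_le0// subr0.
by rewrite max_l ?oppr_ge0// sub0r opprK.
Qed.

Lemma bump_factor_le1 i a u : `|bump_factor i a u| <= 1.
Proof.
rewrite /bump_factor; case: ifP => _; last by rewrite normr1.
by case: ifP => _; rewrite ?normr_id; exact: bump_le1.
Qed.

Lemma bump_factor_part_ge0 s i a u : 0 <= bump_factor_part s i a u.
Proof.
rewrite /bump_factor_part; case: eqP => [_|/eqP ii0]; first by rewrite le_max lexx orbT.
by rewrite /bump_factor (negbTE ii0); case: ifP.
Qed.

Lemma bump_factor_lipschitz i a u v :
  `|bump_factor i a u - bump_factor i a v| <= N%:R * `|u - v|.
Proof.
rewrite /bump_factor; case: ifP => _; last by rewrite subrr normr0 mulr_ge0.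
case: ifP => _; first exact: grid_bump_lipschitz.
by apply: le_trans (grid_bump_lipschitz N a u v); exact: ler_dist_dist.
Qed.

Lemma measurable_bump_factor i a : measurable_fun setT (bump_factor i a).
Proof.
rewrite /bump_factor; case: (i \in K) => //; have mb : measurable_fun setT (@grid_bump R N a) by exact: measurable_grid_bump.
by case: (i == i0) => //; exact: measurableT_comp.
Qed.

Lemma measurable_bump_factor_part s i a :
  measurable_fun setT (bump_factor_part s i a).
Proof.
rewrite /bump_factor_part; case: (i == i0); last exact: measurable_bump_factor.
apply: measurable_maxr => //; apply: measurable_funM => //.
exact: measurable_grid_bump.
Qed.

Lemma measurable_prod_coord (g : 'I_d -> R -> R) :
  (forall i, measurable_fun setT (g i)) ->
  measurable_fun setT (fun x : Rd R d => \prod_i g i (tnth x i)).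
Proof.
move=> mg; apply: measurable_prod => i _.
exact: (measurableT_comp (mg i) (measurable_tnth i)).
Qed.

Lemma product_bump_le1 j x : `|product_bump j x| <= 1.
Proof.
rewrite /product_bump normr_prod; apply: prodr_ile1 => i _.
by rewrite normr_ge0 bump_factor_le1.
Qed.

Lemma product_bump_lipschitz j x y :
  `|product_bump j x - product_bump j y| <=
  N%:R * \sum_i `|tnth x i - tnth y i|.
Proof.
apply: le_trans (ler_norm_prodB _ _) _; [by move=> i; exact: bump_factor_le1..|].
by rewrite mulr_sumr; apply: ler_sum => i _; exact: bump_factor_lipschitz.
Qed.

Lemma product_bump_out j x : ~ product_cell j x -> product_bump j x = 0.
Proof.
move=> nC; have [i iK ni] : exists2 i, i \in K & ~ grid_cell N (j i) (tnth x i).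
  apply: contrapT => h; apply: nC => i iK; apply: contrapT => ni.
  by apply: h; exists i.
rewrite /product_bump (bigD1 i)//= /bump_factor iK grid_bump_out//.
by case: ifP; rewrite ?normr0 mul0r.
Qed.

(** A cell does not constrain its index off [K]; requiring the default [ord0] there makes the
    indexing injective and leaves [N ^ #|K|] cells. *)
Lemma product_cell_inj (i j : {ffun 'I_d -> 'I_N}) x :
  i \in pffun_on ord0 (mem K) predT -> j \in pffun_on ord0 (mem K) predT ->
  product_cell i x -> product_cell j x -> i = j.
Proof.
move=> /pffun_onP[iK _] /pffun_onP[jK _] Cix Cjx; apply/ffunP => k.
have [kK|kK] := boolP (k \in K); last first.
  rewrite (supportP iK) ?(supportP jK)//.
have /andP[/= h1 h2] := Cix k kK; have /andP[/= h3 h4] := Cjx k kK.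
apply/val_inj/eqP; rewrite eqn_leq.
by apply/andP; split; rewrite -ltnS -(ltr_nat R) -natr1; lra.
Qed.

Lemma measurable_product_cell j : measurable (product_cell j).
Proof.
have -> : product_cell j = \bigcap_(i in [set i | i \in K])
    ((fun x : Rd R d => tnth x i) @^-1` grid_cell N (j i)).
  by apply/seteqP; split.
apply: fin_bigcap_measurable; first exact: finite_finset.
move=> i _; rewrite -[X in measurable X]setTI.
by apply: measurable_tnth => //; exact: measurable_grid.
Qed.

Lemma measurable_product_bump j : measurable_fun setT (product_bump j).
Proof.
apply: (@measurable_prod_coord (fun i => bump_factor i (j i))) => i.
exact: measurable_bump_factor.
Qed.

Lemma measurable_product_bump_part s j : measurable_fun setT (product_bump_part s j).
Proof.
apply: (@measurable_prod_coord (fun i => bump_factor_part s i (j i))) => i.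
exact: measurable_bump_factor_part.
Qed.

Lemma product_bump_part_ge0 s j x : 0 <= product_bump_part s j x.
Proof. by apply: prodr_ge0 => i _; exact: bump_factor_part_ge0. Qed.

Lemma depends_on_product_bump j : depends_on (mem K) (product_bump j).
Proof.
move=> x y xy; apply: eq_bigr => i _; rewrite /bump_factor.
by case: ifP => // iK; rewrite xy.
Qed.

Local Open Scope ereal_scope.

Lemma integral_uniform_cube_prod (g : 'I_d -> R -> R) (c : 'I_d -> R) :
  (forall i, measurable_fun setT (g i)) -> (forall i u, 0 <= g i u)%R ->
  (forall i, \int[uniform01 R]_u (g i u)%:E = (c i)%:E) ->
  \int[uniform_cube R d]_x (\prod_i g i (tnth x i))%:E = (\prod_i c i)%:E.
Proof. exact: (@ge0_integral_power_prod _ (measurableTypeR R) R (uniform01 R) d g c). Qed.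

Lemma integral_uniform01_cst1 : \int[uniform01 R]_u (1 : R)%:E = (1 : R)%:E.
Proof.
by rewrite (integral_cst (uniform01 R) measurableT) mul1e [LHS]uniform01T.
Qed.

Lemma integral_product_bump_part j : exists c : R,
  forall s, \int[uniform_cube R d]_x (product_bump_part s j x)%:E = c%:E.
Proof.
have /choice[c cP] (i : 'I_d) :=
  @integral_grid_bump_parts R N (j i) (ltn0Sn _) (ltn_ord (j i)).
exists (\prod_i (if i == i0 then c i else if i \in K then c i + c i else 1))%R => s.
apply: (integral_uniform_cube_prod (g := fun i => bump_factor_part s i (j i))).
- by move=> i; exact: measurable_bump_factor_part.
- by move=> i u; exact: bump_factor_part_ge0.
- move=> i; rewrite /bump_factor_part; have [cp cn ca] := cP i.
  case: eqP => [ii0|/eqP ii0].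
    case: s; first by under eq_integral do rewrite expr1 mulN1r.
    by under eq_integral do rewrite expr0 mul1r.
  rewrite /bump_factor (negbTE ii0); case: (i \in K) => //.
  exact: integral_uniform01_cst1.
Qed.

Lemma prod_if_const (a : R) :
  (\prod_(i < d) (if i \in K then a else 1) = a ^+ #|K|)%R.
Proof. by rewrite -big_mkcond prodr_const. Qed.

Lemma uniform01_indic_grid (a : nat) (u v : R) : (a < N)%N ->
  (0 <= u)%R -> (u < v)%R -> (v <= 1)%R ->
  \int[uniform01 R]_x (\1_[set x : R | (u < N%:R * x - a%:R < v)%R] x)%:E =
  ((v - u) / N%:R)%:E.
Proof.
move=> aN u0 uv v1; rewrite integral_indic//; last exact: measurable_grid.
by rewrite setIT; exact: uniform01_grid.
Qed.

Lemma integral_product_bump_sqr j :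
  \int[uniform_cube R d]_x (product_bump j x ^+ 2)%:E <= (N%:R^-1 ^+ #|K|)%:E.
Proof.
pose g (i : 'I_d) (u : R) : R :=
  (if i \in K then \1_[set u : R | 0 < N%:R * u - (j i)%:R < 1] u else 1)%R.
have mg i : measurable_fun setT (g i).
  by rewrite /g; case: (i \in K) => //; apply: measurable_indic; exact: measurable_grid.
have g0 i u : (0 <= g i u)%R by rewrite /g; case: ifP.
have <- : \int[uniform_cube R d]_x (\prod_i g i (tnth x i))%:E = (N%:R^-1 ^+ #|K|)%:E.
  rewrite -prod_if_const; apply: (integral_uniform_cube_prod (g := g)) => // i.
  rewrite /g; case: (i \in K); last exact: integral_uniform01_cst1.
  by rewrite uniform01_indic_grid// subr0 mul1r.
apply: ge0_le_integral => //.
- by move=> x _; rewrite lee_fin sqr_ge0.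
- by apply/measurable_EFinP/measurable_funX; exact: measurable_product_bump.
- by apply/measurable_EFinP; exact: measurable_prod_coord.
- move=> x _; rewrite lee_fin; have [Cx|nCx] := pselect (product_cell j x); last first.
    by rewrite product_bump_out// expr0n/=; apply: prodr_ge0.
  rewrite big1 => [|i _]; last first.
    by rewrite /g; case: ifP => // iK; rewrite indicE mem_set//; exact: Cx.
  rewrite -real_normK ?num_real// -(expr1n _ 2) lerXn2r// ?nnegrE//.
  exact: product_bump_le1.
Qed.

(** In each coordinate of [K] the bump is at least [5/256] in absolute value on an interval of
    length [1 / (4 N)], which gives [5/1024 / N] per coordinate. *)
Lemma integral_product_bump_abs j :
  ((5 / 1024 / N%:R) ^+ #|K|)%:E <=
  \int[uniform_cube R d]_x (\1_(product_cell j) x * `|product_bump j x|)%:E.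
Proof.
pose I (i : 'I_d) := [set u : R | (8^-1 < N%:R * u - (j i)%:R < 3 / 8)%R].
pose g (i : 'I_d) (u : R) : R := (if i \in K then 5 / 256 * \1_(I i) u else 1)%R.
have mI i : measurable (I i) by exact: measurable_grid.
have mg i : measurable_fun setT (g i).
  by rewrite /g; case: (i \in K) => //; apply: measurable_funM => //; exact: measurable_indic.
have g0 i u : (0 <= g i u)%R by rewrite /g; case: ifP => // _; rewrite mulr_ge0// divr_ge0.
have <- : \int[uniform_cube R d]_x (\prod_i g i (tnth x i))%:E =
    ((5 / 1024 / N%:R) ^+ #|K|)%:E.
  rewrite -prod_if_const; apply: (integral_uniform_cube_prod (g := g)) => // i.
  rewrite /g; case: (i \in K); last exact: integral_uniform01_cst1.
  under eq_integral do rewrite EFinM.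
  rewrite ge0_integralZl//; last first.
    by apply/measurable_EFinP; apply: measurable_indic; exact: (mI i).
  rewrite uniform01_indic_grid//; [|by lra..].
  by rewrite -EFinM; congr (_%:E); field; rewrite gt_eqF.
apply: ge0_le_integral => //.
- by move=> x _; rewrite lee_fin; apply: prodr_ge0.
- by apply/measurable_EFinP; exact: measurable_prod_coord.
- apply/measurable_EFinP; apply: measurable_funM.
    by apply: measurable_indic; exact: measurable_product_cell.
  by apply: measurableT_comp => //; exact: measurable_product_bump.
- move=> x _; rewrite lee_fin.
  have [xI|nxI] := pselect (forall i, i \in K -> I i (tnth x i)).
    have Cx : product_cell j x.
      by move=> i iK; have := xI i iK; rewrite /I /grid_cell/= => /andP[? ?];
        apply/andP; split; lra.
    rewrite indicE mem_set// mul1r normr_prod; apply: ler_prod => i _.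
    rewrite g0 /g /bump_factor; case: ifP => [iK|_]; last by rewrite normr1 ?ler01 ?lexx.
    rewrite indicE mem_set ?mulr1; last exact: xI.
    suff : (5 / 256 <= `|grid_bump N (j i) (tnth x i)|)%R.
      by case: (i == i0); rewrite ?normr_id.
    apply: le_trans (ler_norm _); apply: bump_ge.
    by have := xI i iK; rewrite /I/= => /andP[/ltW-> /ltW->].
  have [i iK ni] : exists2 i, i \in K & ~ I i (tnth x i).
    apply: contrapT => h; apply: nxI => i iK; apply: contrapT => ni.
    by apply: h; exists i.
  by rewrite (bigD1 i)//= /g iK indicE memNset// mulr0 mul0r mulr_ge0.
Qed.

End product_bump.

(** * A hard perturbation of a density *)

Section hard_perturbation.
Variables (R : realType) (d : nat) (K : {set 'I_d}) (i0 : 'I_d) (N' : nat).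
Hypothesis i0K : i0 \in K.
Local Notation N := N'.+1.
Local Notation r := #|K|.
Local Notation J := {j : {ffun 'I_d -> 'I_N} | j \in pffun_on ord0 (mem K) predT}.
Variables (c : R) (q : Rd R d -> R).
Hypotheses (c0 : 0 < c) (c8 : c <= 8^-1) (mq : measurable_fun setT q)
  (q_ge : forall x, 2^-1 + c / N%:R <= q x)
  (q1 : (\int[uniform_cube R d]_x (q x)%:E = 1)%E)
  (Kq : depends_on (mem K) q).

Definition scaled_bump (j : J) (x : Rd R d) : R :=
  c / N%:R * product_bump K i0 (val j) x.

Definition perturbed (s : {ffun J -> bool}) (x : Rd R d) : R :=
  q x + cell_sum scaled_bump s x.

Let N0 : 0 < N%:R :> R. Proof. by rewrite ltr0n. Qed.
Let cN0 : 0 < c / N%:R. Proof. by rewrite divr_gt0. Qed.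

Let C (j : J) : set (Rd R d) := product_cell K (val j).

Let dC (i j : J) x : C i x -> C j x -> i = j.
Proof. by move=> Ci Cj; apply/val_inj/(product_cell_inj (valP i) (valP j) Ci Cj). Qed.

Let out j x : ~ C j x -> scaled_bump j x = 0.
Proof. by move=> nC; rewrite /scaled_bump product_bump_out ?mulr0. Qed.

Let measurable_scaled_bump j : measurable_fun setT (scaled_bump j).
Proof. by apply: measurable_funM => //; exact: measurable_product_bump. Qed.

Lemma perturbed_near s x : `|perturbed s x - q x| <= c / N%:R.
Proof.
rewrite /perturbed addrAC subrr add0r; apply: (cell_sum_le dC out) => [|j]; first exact: ltW.
rewrite /scaled_bump normrM (ger0_norm (ltW cN0)) ler_piMr ?(ltW cN0)//.
exact: product_bump_le1.
Qed.

Lemma perturbed_ge s x : 2^-1 <= perturbed s x.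
Proof.
have := perturbed_near s x; have := q_ge x.
by rewrite ler_norml; move: (c / _) (perturbed s x) (q x) => b p0 p1 ? /andP[? _]; lra.
Qed.

Lemma perturbed_lipschitz s x y :
  `|(perturbed s x - q x) - (perturbed s y - q y)| <=
  2 * c * \sum_i `|tnth x i - tnth y i|.
Proof.
rewrite /perturbed ![q _ + _]addrC !addrK -mulrA.
apply: (cell_sum_dist dC out) => [|j].
  by rewrite mulr_ge0 ?(ltW c0)// sumr_ge0.
rewrite /scaled_bump -mulrBr normrM (ger0_norm (ltW cN0)).
apply: le_trans (ler_wpM2l (ltW cN0) (product_bump_lipschitz K i0 _ x y)) _.
by rewrite mulrA divfK// gt_eqF.
Qed.

Lemma measurable_perturbed s : measurable_fun setT (perturbed s).
Proof.
apply: measurable_funD => //; apply: measurable_sum => j.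
exact: measurable_funM.
Qed.

Lemma depends_on_perturbed s : depends_on (mem K) (perturbed s).
Proof.
move=> x y xy; rewrite /perturbed (Kq xy); congr (_ + _).
apply: eq_bigr => j _; congr (_ * (_ * _)).
exact: depends_on_product_bump xy.
Qed.

Lemma integral_perturbed s :
  (\int[uniform_cube R d]_x (perturbed s x)%:E = 1)%E.
Proof.
(* A negative sign on a cell exchanges the positive and negative parts of its bump, hence the
   exclusive or. *)
pose part (b : bool) (j : J) x := c / N%:R * product_bump_part K i0 (b (+) s j) (val j) x.
have part0 b j x : 0 <= part b j x.
  by rewrite /part mulr_ge0 ?(ltW cN0) ?product_bump_part_ge0.
have mpart b j : measurable_fun setT (fun x => (part b j x)%:E).
  apply/measurable_EFinP/measurable_funM => //; exact: measurable_product_bump_part.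
have /choice[a aP] : forall j : J, exists a : R, forall b,
    (\int[uniform_cube R d]_x (product_bump_part K i0 b (val j) x)%:E = a%:E)%E.
  by move=> j; exact: integral_product_bump_part.
have intpart b j : (\int[uniform_cube R d]_x (part b j x)%:E = (c / N%:R * a j)%:E)%E.
  under eq_integral do rewrite EFinM.
  rewrite ge0_integralZl//; last 3 first.
  - by apply/measurable_EFinP; exact: measurable_product_bump_part.
  - by move=> x _; rewrite lee_fin product_bump_part_ge0.
  - by rewrite lee_fin ltW.
  by rewrite aP.
(* Negative parts are moved to the left, so that every term is nonnegative; the two sums have the
   same finite integral and cancel. *)
have E x : perturbed s x + \sum_j part true j x = q x + \sum_j part false j x.
  rewrite /perturbed -addrA; congr (_ + _); rewrite /cell_sum -big_split/=.
  apply: eq_bigr => j _; rewrite /scaled_bump product_bumpE// /part.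
  by case: (s j); rewrite /= ?expr0 ?expr1; ring.
have p0 x : 0 <= perturbed s x by apply: le_trans (perturbed_ge s x).
have qx0 x : 0 <= q x by apply: le_trans (q_ge x); rewrite addr_ge0// ltW.
have mp := measurable_perturbed s.
have mS b : measurable_fun setT (fun x => (\sum_j (part b j x)%:E)%E).
  by apply: emeasurable_sum => j.
have S0 b x : (0 <= \sum_j (part b j x)%:E)%E.
  by apply: sume_ge0 => j _; rewrite lee_fin.
have Sint b : (\int[uniform_cube R d]_x (\sum_j (part b j x)%:E) =
    (\sum_j c / N%:R * a j)%:E)%E.
  rewrite ge0_integral_sum//; last by move=> j x _; rewrite lee_fin.
  by rewrite -sumEFin; apply: eq_bigr => j _; exact: intpart.
have : (\int[uniform_cube R d]_x ((perturbed s x)%:E + \sum_j (part true j x)%:E) =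
    \int[uniform_cube R d]_x ((q x)%:E + \sum_j (part false j x)%:E))%E.
  by apply: eq_integral => x _; rewrite !sumEFin -!EFinD E.
rewrite ge0_integralD//; last 2 first.
- by move=> x _; rewrite lee_fin.
- exact/measurable_EFinP.
rewrite ge0_integralD//; last 2 first.
- by move=> x _; rewrite lee_fin.
- exact/measurable_EFinP.
rewrite q1 !Sint; case: (\int[_]_x (perturbed s x)%:E)%E => [z| |]//.
by rewrite -!EFinD => -[] zE; congr (_%:E); lra.
Qed.

Lemma card_cells : #|{: J}| = (N ^ r)%N.
Proof. by rewrite card_sig card_pffun_on card_ord. Qed.

Lemma exists_hard_perturbation
    (phat : (N ^ (2 + r)).-tuple (Rd R d) -> Rd R d -> R) :
  measurable_fun setT
    (fun tx : (N ^ (2 + r)).-tuple (Rd R d) * Rd R d => phat tx.1 tx.2) ->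
  exists s, ((8^-1)%:E <= lik_mass (uniform_cube R d) (perturbed s)
    [set t | (c * (5 / 1024) ^+ r / (8 * N%:R))%:E <
      L1_error (uniform_cube R d) (perturbed s) phat t])%E.
Proof.
move=> mphat.
have absE (k b : R) (e : bool) : 0 < k -> `|2 * (-1) ^+ e * (k * b)| = 2 * k * `|b|.
  move=> k0; rewrite !normrM normr_sign mulr1 (ger0_norm (ltW k0)) mulrA.
  by rewrite ger0_norm.
(* A flip doubles the scaled bump: [2 * w] bounds its L1 effect on the cell from below, and [v]
   bounds its squared L2 effect from above. Over [N ^ r] cells, [w * N ^ r / 8] is exactly the
   announced error. *)
pose w := c / N%:R * (5 / 1024 / N%:R) ^+ r.
pose v := 4 * (c / N%:R) ^+ 2 * N%:R^-1 ^+ r.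
have flipE s j x : perturbed s x - perturbed (flip j s) x =
    2 * (-1) ^+ s j * scaled_bump j x.
  by rewrite /perturbed -cell_sum_flip; ring.
apply: (@assouad _ _ _ (uniform_cube R d) _ _ perturbed C phat v w) => //.
- exact: measurable_perturbed.
- exact: perturbed_ge.
- exact: integral_perturbed.
- by move=> j; exact: measurable_product_cell.
- by rewrite card_cells expn_gt0.
- rewrite /w; apply: (mulr_gt0 cN0); apply: exprn_gt0; apply: divr_gt0 N0.
  by lra.
- move=> s j.
  under eq_integral => x _.
    rewrite (_ : _ * _ = 2 * (c / N%:R) *
      (\1_(product_cell K (val j)) x * `|product_bump K i0 (val j) x|)); last first.
      rewrite flipE /scaled_bump.
      by rewrite absE// mulrCA.
    rewrite EFinM; over.
  rewrite /= ge0_integralZl//; last 2 first.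
  - apply/measurable_EFinP/measurable_funM.
      by apply: measurable_indic; exact: measurable_product_cell.
    by apply: measurableT_comp => //; exact: measurable_product_bump.
  - by rewrite lee_fin mulr_ge0// ltW.
  rewrite /w mulrA EFinM lee_pmul2l ?lte_fin ?mulr_gt0//.
  exact: integral_product_bump_abs.
- move=> s j.
  under eq_integral => x _.
    rewrite (_ : _ ^+ 2 = 4 * (c / N%:R) ^+ 2 *
      product_bump K i0 (val j) x ^+ 2); last first.
      by rewrite flipE /scaled_bump !exprMn sqrr_sign; ring.
    rewrite EFinM; over.
  have k0 : 0 <= 4 * (c / N%:R) ^+ 2 by rewrite mulr_ge0 ?sqr_ge0.
  rewrite /= ge0_integralZl//; last 2 first.
  - by apply/measurable_EFinP/measurable_funX; exact: measurable_product_bump.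
  - by move=> x _; rewrite lee_fin sqr_ge0.
  rewrite /v [leRHS]EFinM; apply: lee_wpmul2l; first by rewrite lee_fin.
  exact: integral_product_bump_sqr.
- have v0 : 0 <= v.
    rewrite /v; apply: mulr_ge0; first by apply: mulr_ge0 => //; exact: sqr_ge0.
    by apply: exprn_ge0; rewrite invr_ge0 ltW.
  apply: expr1D_le; first by apply: mulr_ge0.
  (* All powers of [N] cancel, and [c <= 1/8] leaves at most [1/8], below the [1/5] that [expr1D_le]
     allows. *)
  have -> : (N ^ (2 + r))%:R * (2 * v) = 8 * c ^+ 2 :> R.
    rewrite /v natrX exprD exprMn !exprVn; field.
    by rewrite expf_neq0 gt_eqF.
  have : c ^+ 2 <= 8^-1 ^+ 2 by rewrite lerXn2r// nnegrE ltW.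
  by lra.
- have E (k x y : R) : x != 0 -> y != 0 ->
      c * k / (8 * x) = c / x * (k / y) * y / 8 by move=> x0 y0; field; rewrite x0 y0.
  have Nn0 : N%:R != 0 :> R by rewrite gt_eqF.
  by rewrite card_cells natrX /w (expr_div_n (5 / 1024) N%:R) -E// expf_neq0.
Qed.

End hard_perturbation.

(** * Successive perturbations *)

Lemma bernoulli_ge (R : realFieldType) (x : R) n : 0 <= x <= 1 ->
  1 - n%:R * x <= (1 - x) ^+ n.
Proof.
move=> /andP[x0 x1]; elim: n => [|n IH]; first by rewrite mul0r subr0 expr0.
rewrite exprS; apply: (@le_trans _ _ ((1 - x) * (1 - n%:R * x))).
  by have n0 : 0 <= n%:R :> R := ler0n _ _; rewrite -natr1; nra.
by rewrite ler_wpM2l// subr_ge0.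
Qed.

(** At the sample size [N ^ (2 + r)] the rate is [N ^ (- 1 - g)] with [g = eps / (2 + r - eps)]
    positive, so it suffices that [N ^ g >= M / B]. *)
Lemma exists_rate_le (R : realType) (r k : nat) (eps M B : R) :
  0 < eps -> eps < 2 + r%:R -> 0 <= M -> 0 < B ->
  exists2 N', (k <= N')%N &
    M * ((N'.+1 ^ (2 + r))%:R `^ (- (2 + r%:R - eps)^-1)) <= B / N'.+1%:R.
Proof.
move=> e0 er M0 B0.
have b0 : 0 < 2 + r%:R - eps by rewrite subr_gt0.
pose g := eps / (2 + r%:R - eps); have g0 : 0 < g by rewrite divr_gt0.
have [m m_ge] : exists m : nat, (M / B) `^ g^-1 <= m%:R.
  exists (Num.bound ((M / B) `^ g^-1)); apply/ltW/archi_boundP.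
  exact: powR_ge0.
exists (k + m)%N; first exact: leq_addr.
set N := (k + m).+1; have N0 : 0 < N%:R :> R by rewrite ltr0n.
have MB0 : 0 <= M / B by rewrite divr_ge0// ltW.
have Ng : M / B <= N%:R `^ g.
  have <- : ((M / B) `^ g^-1) `^ g = M / B by rewrite -powRrM mulVf ?lt0r_neq0// powRr1.
  rewrite ge0_ler_powR ?nnegrE ?powR_ge0 ?(ltW g0) ?(ltW N0)//.
  by apply: le_trans m_ge _; rewrite ler_nat leqW// leq_addl.
have -> : (N ^ (2 + r))%:R `^ (- (2 + r%:R - eps)^-1) = (N%:R `^ g)^-1 / N%:R :> R.
  rewrite natrX -powR_mulrn// -powRrM natrD.
  rewrite (_ : (2 + r%:R) * - (2 + r%:R - eps)^-1 = - g + - 1); last first.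
    by rewrite /g; field; rewrite gt_eqF.
  by rewrite powRD ?(gt_eqF N0) ?implybT// !powRN powRr1// ltW.
rewrite mulrA ler_wpM2r ?invr_ge0 ?(ltW N0)//.
by rewrite ler_pdivrMr ?powR_gt0// -ler_pdivrMl// mulrC.
Qed.

Section gliding_hump.
Variables (R : realType) (d : nat) (K : {set 'I_d}) (i0 : 'I_d).
Hypothesis i0K : i0 \in K.
Variables (eps : R) (phat : estimator R d).
Hypotheses (eps_gt0 : 0 < eps) (eps_lt : eps < 2 + #|K|%:R)
  (mphat : measurable_estimator phat).

Local Notation Q := (uniform_cube R d).

Definition rate (n : nat) : R := n%:R `^ (- (2 + #|K|%:R - eps)^-1).

Definition l1_distance (x y : Rd R d) : R := \sum_i `|tnth x i - tnth y i|.

(* [z] is what may still be spent, in sup norm and in Lipschitz constant, on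
   further perturbations of [q]. *)
Definition admissible (q : Rd R d -> R) (z : R) : Prop :=
  [/\ measurable_fun setT q, (\int[Q]_x (q x)%:E = 1)%E, depends_on (mem K) q,
      0 < z <= 2^-1 &
      (forall x, 2^-1 + z <= q x) /\
      (forall x y, `|q x - q y| <= (1 - z) * l1_distance x y)].

(** The next budget is limited in three ways: [z' <= z / 2] makes the distances telescope,
    [4 n z' <= 1] makes the likelihoods of later densities at least half that of [q'], and
    [z' <= rate n] lets the L1 error drop by at most one multiple of the rate. *)
Definition refines (k : nat) (q : Rd R d -> R) (z : R) (q' : Rd R d -> R) (z' : R) :=
  [/\ z' <= z / 2, forall x, `|q' x - q x| <= z / 2 &
    exists n, [/\ (k <= n)%N, 4 * n%:R * z' <= 1, 0 < rate n, z' <= rate n &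
      ((8^-1)%:E <= lik_mass Q q'
        [set t | (k%:R * rate n)%:E < L1_error Q q' (phat (n := n)) t])%E]].

Lemma l1_distance_ge0 x y : 0 <= l1_distance x y.
Proof. by apply: sumr_ge0. Qed.

Lemma admissible_refines k q z : admissible q z ->
  exists q' z', admissible q' z' /\ refines k q z q' z'.
Proof.
move=> [mq q1 Kq /andP[z0 z2] [q_ge q_lip]].
(* The perturbation has height at most [z / 4] and adds [2 c = z / 2] to the Lipschitz constant, so
   that a budget of [z / 2] remains for both. *)
pose c := z / 4; have c0 : 0 < c by rewrite divr_gt0.
have c8 : c <= 8^-1 by rewrite /c; lra.
have kappa0 : 0 < c * (5 / 1024) ^+ #|K| / 8.
  apply: divr_gt0; last by lra.
  by apply: (mulr_gt0 c0); apply: exprn_gt0; lra.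
have [N' kN' rate_le] := @exists_rate_le R #|K| k eps k%:R _ eps_gt0 eps_lt (ler0n _ _) kappa0.
set N := N'.+1 in rate_le; have N1 : 1 <= N%:R :> R by rewrite ler1n.
have cN : c / N%:R <= c by rewrite ler_pdivrMr ?ler_peMr ?(ltW c0)// (lt_le_trans ltr01).
have q_ge' x : 2^-1 + c / N%:R <= q x.
  by apply: le_trans (q_ge x); rewrite lerD2l (le_trans cN)// /c; lra.
pose n := (N ^ (2 + #|K|))%N.
have n0 : (0 < n)%N by rewrite expn_gt0.
have [s hard] := exists_hard_perturbation (N' := N') i0K c0 c8 mq q_ge' q1 (@mphat n).
pose q' := perturbed i0 c q s.
have near x : `|q' x - q x| <= z / 4.
  by apply: le_trans cN; exact: perturbed_near.
have rate0 : 0 < rate n by apply: powR_gt0; rewrite ltr0n.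
have nR : 0 < n%:R :> R by rewrite ltr0n.
pose z' := Num.min (z / 2) (Num.min ((4 * n%:R)^-1) (rate n)).
have z'_half : z' <= z / 2 by rewrite ge_min lexx.
have z'0 : 0 < z' by rewrite !lt_min divr_gt0// invr_gt0 mulr_gt0.
exists q', z'; split.
  split; [exact: measurable_perturbed|exact: (integral_perturbed (i0 := i0) i0K c0)
    |exact: depends_on_perturbed| |split].
  - by rewrite z'0; lra.
  - move=> x; have := near x; rewrite ler_norml => /andP[h _].
    by have := q_ge x; lra.
  - move=> x y.
    rewrite (_ : q' x - q' y = (q x - q y) + ((q' x - q x) - (q' y - q y))); last by ring.
    apply: le_trans (ler_normD _ _) _.
    have h : `|(q' x - q x) - (q' y - q y)| <= 2 * c * l1_distance x y.
      exact: perturbed_lipschitz.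
    have := q_lip x y; have := l1_distance_ge0 x y; move: h.
    by rewrite /c; nra.
split => //.
  by move=> x; apply: le_trans (near x) _; lra.
exists n; split => //.
- apply: leq_trans kN' _; apply: leq_trans (leqnSn _) _.
  by rewrite -/N /n addSn expnS leq_pmulr// expn_gt0.
- rewrite -ler_pdivlMl ?mulr_gt0// mulr1.
  by rewrite /z' !ge_min lexx orbT.
- by rewrite /z' !ge_min lexx !orbT.
(* By the choice of [N], the threshold [k * rate n] lies below the one in [hard], so the event only
   grows. *)
- set B := [set t | _] in hard; apply: le_trans hard _.
  have mE t : measurable [set x | (t%:E < L1_error Q q' (phat (n := n)) x)%E].
    by apply: measurable_L1_error_gt; [exact: measurable_perturbed|exact: mphat].
  have q'0 x : 0 <= q' x.
    have := near x; rewrite ler_norml => /andP[h _].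
    by have := q_ge x; lra.
  apply: ge0_le_integral => //.
  - by move=> t _; rewrite lee_fin mulr_ge0// lik_ge0.
  - apply: measurable_indic_lik; [exact: measurable_perturbed|exact: mE].
  - apply: measurable_indic_lik; [exact: measurable_perturbed|exact: mE].
  - move=> t _; rewrite lee_fin ler_wpM2r ?lik_ge0// !indicE.
    rewrite -/B; have [/set_mem Ht|//] := boolP (t \in B).
    rewrite mem_set//=; apply: le_lt_trans Ht; rewrite lee_fin.
    apply: le_trans rate_le _; rewrite le_eqVlt; apply/orP; left; apply/eqP.
    by rewrite invfM !mulrA.
Qed.

End gliding_hump.

(** * The limit density *)

Section limit_density.
Variables (R : realType) (d : nat) (K : {set 'I_d}) (i0 : 'I_d).
Hypothesis i0K : i0 \in K.
Variables (eps : R) (phat : estimator R d).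
Hypotheses (eps_gt0 : 0 < eps) (eps_lt : eps < 2 + #|K|%:R)
  (mphat : measurable_estimator phat).
Local Notation Q := (uniform_cube R d).
Local Notation rate := (rate K eps).

Lemma uniform_cubeT : Q setT = 1%E.
Proof.
rewrite -[LHS]mul1e -(integral_cst Q measurableT).
have -> : (cst 1%E : Rd R d -> \bar R) =
    fun x => (\prod_(i < d) (cst 1 : R -> R) (tnth x i))%:E.
  by apply/funext => x; rewrite big1.
rewrite (integral_uniform_cube_prod (g := fun=> cst 1) (c := fun=> 1))//.
  by rewrite big1.
by move=> i; exact: integral_uniform01_cst1.
Qed.

Lemma integral_uniform_cube_cst (z : R) : (\int[Q]_x z%:E = z%:E)%E.
Proof.
by rewrite (integral_cst Q measurableT) [X in (_ * X)%E]uniform_cubeT mule1.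
Qed.

Lemma exists_refining_sequence :
  exists (q_ : nat -> Rd R d -> R) (z_ : nat -> R),
    (forall k, admissible K (q_ k) (z_ k)) /\
    (forall k, refines K eps phat k (q_ k) (z_ k) (q_ k.+1) (z_ k.+1)).
Proof.
(* The stage number is part of the state, because the refinement demanded depends on it. *)
pose X := {y : nat * ((Rd R d -> R) * R) | admissible K y.2.1 y.2.2}.
have ad0 : admissible K (cst 1 : Rd R d -> R) 2^-1.
  split => //.
  - exact: integral_uniform_cube_cst.
  - by rewrite invr_gt0 ltr0n lexx.
  - split; first by move=> x; rewrite /=; lra.
    move=> x y; rewrite subrr normr0 mulr_ge0 ?l1_distance_ge0//; lra.
have next (x : X) : {y : X | (sval y).1 = (sval x).1.+1 /\
    refines K eps phat (sval x).1 (sval x).2.1 (sval x).2.2 (sval y).2.1 (sval y).2.2}.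
  apply: cid; have [q [z [ad ref]]] :=
    admissible_refines i0K eps_gt0 eps_lt mphat (sval x).1 (svalP x).
  by exists (exist _ ((sval x).1.+1, (q, z)) ad).
have [f [f0 fS]] := dependent_choice next (exist _ (0%N, (cst 1, 2^-1)) ad0).
have f1 k : (sval (f k)).1 = k.
  by elim: k => [|k IH]; [rewrite f0|have [-> _] := fS k; rewrite IH].
exists (fun k => (sval (f k)).2.1), (fun k => (sval (f k)).2.2); split.
  by move=> k; exact: (svalP (f k)).
by move=> k; have [_] := fS k; rewrite f1.
Qed.

Variables (q_ : nat -> Rd R d -> R) (z_ : nat -> R).
Hypotheses (adm : forall k, admissible K (q_ k) (z_ k))
  (ref : forall k, refines K eps phat k (q_ k) (z_ k) (q_ k.+1) (z_ k.+1)).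

Let z_gt0 k : 0 < z_ k. Proof. by have [_ _ _ /andP[]] := adm k. Qed.
Let z_half k : z_ k.+1 <= z_ k / 2. Proof. by have [] := ref k. Qed.

Let z_small k : z_ k * k.+1%:R <= 1.
Proof.
elim: k => [|k IH].
  by have [_ _ _ /andP[_ h] _] := adm 0; lra.
have k0 : 0 <= k%:R :> R by [].
have zk := z_gt0 k.
apply: (@le_trans _ _ (z_ k / 2 * k.+2%:R)); first by rewrite ler_wpM2r.
by have := mulr_ge0 (ltW zk) k0; move: IH; rewrite -(natr1 k.+1) -(natr1 k); lra.
Qed.

Let z_lt (del : R) : 0 < del -> exists k, z_ k < del.
Proof.
move=> del0; exists (Num.bound del^-1); set k := Num.bound _.
have kd : del^-1 < k.+1%:R.
  apply: lt_le_trans (archi_boundP _) _; first by rewrite invr_ge0 ltW.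
  by rewrite ler_nat.
have k0 : 0 < k.+1%:R :> R by rewrite ltr0n.
have : z_ k <= k.+1%:R^-1 by rewrite -[leRHS]mul1r ler_pdivlMr.
by move/le_lt_trans; apply; rewrite invf_plt ?posrE.
Qed.

(** Written as a difference of budgets so that successive steps telescope. *)
Let near_step k x : `|q_ k.+1 x - q_ k x| <= z_ k - z_ k.+1.
Proof.
have [_ /(_ x) h _] := ref k; apply: le_trans h _.
by have := z_half k; lra.
Qed.

Let near_dist k l x : (k <= l)%N -> `|q_ l x - q_ k x| <= z_ k - z_ l.
Proof.
move=> /subnKC <-; elim: (l - k)%N => [|n IH]; first by rewrite addn0 !subrr normr0.
rewrite addnS (_ : _ - _ = (q_ (k + n).+1 x - q_ (k + n) x) + (q_ (k + n) x - q_ k x));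
  last by ring.
apply: le_trans (ler_normD _ _) _.
by have := near_step (k + n) x; lra.
Qed.

(* [q_ k + z_ k] decreases with [k], so that its infimum is the limit of [q_]. *)
Definition limit_density (x : Rd R d) : R := infs (fun k => q_ k x + z_ k) 0.

Let le_shift k l x : q_ k x - z_ k <= q_ l x + z_ l.
Proof.
have [kl|/ltnW lk] := leqP k l.
  have := near_dist x kl; rewrite ler_norml => /andP[h _].
  by have := z_gt0 l; lra.
have := near_dist x lk; rewrite ler_norml => /andP[_ h].
by have := z_gt0 k; lra.
Qed.

Let lb x : has_lbound (range (fun k => q_ k x + z_ k)).
Proof. by exists (q_ 0 x - z_ 0) => _ [l _ <-]; exact: le_shift. Qed.

Let limitE x : limit_density x = inf (range (fun k => q_ k x + z_ k)).
Proof.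
rewrite /limit_density /infs /sdrop; congr (inf _).
by apply/seteqP; split => y [k _ <-]; exists k.
Qed.

Lemma limit_density_near k x : `|limit_density x - q_ k x| <= z_ k.
Proof.
rewrite limitE ler_norml; apply/andP; split.
  rewrite lerBrDl; apply: lb_le_inf; first by exists (q_ 0 x + z_ 0); exists 0.
  by move=> _ [l _ <-]; exact: le_shift.
by rewrite lerBlDl; apply: ge_inf => //; exists k.
Qed.

Lemma limit_density_ge x : 2^-1 <= limit_density x.
Proof.
rewrite limitE; apply: lb_le_inf; first by exists (q_ 0 x + z_ 0); exists 0.
move=> _ [l _ <-]; have [_ _ _ _ [/(_ x) h _]] := adm l.
by have := z_gt0 l; lra.
Qed.

Lemma measurable_limit_density : measurable_fun setT limit_density.
Proof.
apply: (measurable_fun_infs (h := fun k x => q_ k x + z_ k)).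
  move=> x _; have [M MP] := lb x; exists M => y [k _ <-]; exact: MP.
by move=> k; apply: measurable_funD => //; have [] := adm k.
Qed.

Lemma depends_on_limit_density : depends_on (mem K) limit_density.
Proof.
move=> x y xy; rewrite /limit_density; congr (infs _ _); apply/funext => k.
by have [_ _ /(_ x y xy) -> _ _] := adm k.
Qed.

Lemma limit_density_lipschitz x y :
  `|limit_density x - limit_density y| <= l1_distance x y.
Proof.
apply/ler_addgt0Pr => del del0; have [|k kd] := @z_lt (del / 2); first by rewrite divr_gt0.
have [_ _ _ /andP[z0 _] [_ /(_ x y) h]] := adm k.
have := limit_density_near k x; have := limit_density_near k y.
rewrite !ler_norml in h *; move: h => /andP[? ?] /andP[? ?] /andP[? ?].
have := l1_distance_ge0 x y => ?.
by apply/andP; split; nra.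
Qed.

Local Open Scope ereal_scope.

Let mlimit := measurable_limit_density.

Let limit0 x : (0 <= limit_density x)%R.
Proof. exact: le_trans (limit_density_ge x). Qed.

(** The convergence is uniform and [Q] has mass one, so the integral differs from one by at most
    [z_ k] for every [k]. *)
Lemma integral_limit_density : \int[Q]_x (limit_density x)%:E = 1.
Proof.
have addz (f : Rd R d -> R) (z : R) : measurable_fun setT f -> (forall x, 0 <= f x)%R ->
    (0 <= z)%R -> \int[Q]_x (f x + z)%:E = \int[Q]_x (f x)%:E + z%:E.
  move=> mf f0 z0; under eq_integral do rewrite EFinD.
  rewrite ge0_integralD ?integral_uniform_cube_cst//.
  - by move=> x _; rewrite lee_fin.
  - exact/measurable_EFinP.
have mono (f g : Rd R d -> R) : measurable_fun setT f -> measurable_fun setT g ->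
    (forall x, 0 <= f x <= g x)%R -> \int[Q]_x (f x)%:E <= \int[Q]_x (g x)%:E.
  move=> mf mg fg; apply: ge0_le_integral => //.
  - by move=> x _; rewrite lee_fin; case/andP: (fg x).
  - exact/measurable_EFinP.
  - exact/measurable_EFinP.
  - by move=> x _; rewrite lee_fin; case/andP: (fg x).
have q0 k x : (0 <= q_ k x)%R.
  have [_ _ _ _ [/(_ x) h _]] := adm k; apply: le_trans h.
  by rewrite addr_ge0// ltW.
have ub k : \int[Q]_x (limit_density x)%:E <= (1 + z_ k)%:E.
  have [mq q1 _ _ _] := adm k.
  rewrite EFinD -q1 -addz ?(ltW (z_gt0 k))//; apply: mono => // [|x].
    exact: measurable_funD.
  by rewrite limit0; have := limit_density_near k x; rewrite ler_norml => /andP[_]; lra.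
have lb' k : 1 <= \int[Q]_x (limit_density x)%:E + (z_ k)%:E.
  have [mq q1 _ _ _] := adm k.
  rewrite -q1 -addz ?(ltW (z_gt0 k))//; apply: mono => // [|x].
    exact: measurable_funD.
  by rewrite q0; have := limit_density_near k x; rewrite ler_norml => /andP[h _]; lra.
case: (\int[Q]_x (limit_density x)%:E) ub lb' => [P| |] ub lb'.
- congr (_%:E); apply/eqP; rewrite eq_le; apply/andP; split;
    apply/ler_addgt0Pr => del /z_lt[k kd].
    by have := ub k; rewrite lee_fin; lra.
  by have := lb' k; rewrite -EFinD lee_fin; lra.
- by have := ub 0%N.
- by have := lb' 0%N.
Qed.

Lemma limit_density_hard k : exists n, [/\ (k <= n)%N, (0 < rate n)%R &
  (16^-1)%:E <= lik_mass Q limit_density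
    [set t | ((k%:R - 1) * rate n)%:E < L1_error Q limit_density (phat (n := n)) t]].
Proof.
have [_ _ [n [kn nz rate0 z_rate hard]]] := ref k.
exists n; split => //.
set z := z_ k.+1 in nz z_rate; set q := q_ k.+1 in hard.
have z0 : (0 < z)%R := z_gt0 k.+1.
have [mq _ _ /andP[_ z2] [q_ge _]] := adm k.+1.
rewrite -/q -/z in mq z2 q_ge.
have near x : (`|limit_density x - q x| <= z)%R by exact: limit_density_near.
have q2 x : (2^-1 <= q x)%R by apply: le_trans (q_ge x); rewrite lerDl ltW.
have q0 x : (0 <= q x)%R by apply: le_trans (q2 x).
set B' := [set t | _] in hard; set B := [set t | _].
have mB' : measurable B' by exact: measurable_L1_error_gt.
have mB : measurable B by exact: measurable_L1_error_gt.
have L1_le t : L1_error Q q (phat (n := n)) t <=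
    L1_error Q limit_density (phat (n := n)) t + z%:E.
  rewrite /L1_error -[X in _ + X]integral_uniform_cube_cst.
  have mph : measurable_fun setT (phat (n := n) t).
    exact: (measurableT_comp (@mphat n) (measurable_pair1 t)).
  have mabs (f : Rd R d -> R) : measurable_fun setT f ->
      measurable_fun setT (fun x => (`|f x - phat t x|)%:E).
    move=> mf; apply/measurable_EFinP/measurableT_comp => //.
    exact: measurable_funB.
  rewrite -ge0_integralD//; [|exact: mabs|by move=> x _; rewrite lee_fin ltW].
  apply: ge0_le_integral => //.
  - exact: mabs.
  - by apply: emeasurable_funD => //; exact: mabs.
  - move=> x _; rewrite -EFinD lee_fin.
    rewrite (_ : q x - phat t x = (limit_density x - phat t x) - (limit_density x - q x))%R;
      last by ring.
    by apply: le_trans (ler_normB _ _) _; rewrite lerD2l.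
have BB' : B' `<=` B.
  move=> t; rewrite /B' /B/= !ltNge => /negP h; apply/negP => L1p; apply: h.
  apply: le_trans (L1_le t) _; apply: (le_trans (leeD L1p (lexx _))).
  by rewrite -EFinD lee_fin; lra.
(* From [q >= 1/2] comes [limit_density >= q - z >= (1 - 2 z) q], and Bernoulli's inequality with
   [4 n z <= 1] bounds [(1 - 2 z) ^ n] below by [1/2]. This halves the mass [1/8] to [1/16]. *)
have lik_le t : (2^-1 * lik q t <= lik limit_density (t : n.-tuple (Rd R d)))%R.
  apply: (@le_trans _ _ ((1 - 2 * z) ^+ n * lik q t)%R).
    rewrite ler_wpM2r ?lik_ge0//; apply: le_trans (bernoulli_ge _ _).
      by lra.
    by apply/andP; split; lra.
  have -> : ((1 - 2 * z) ^+ n = \prod_(i < n) (1 - 2 * z))%R.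
    by rewrite prodr_const card_ord.
  rewrite /lik -big_split/=; apply: ler_prod => i _; apply/andP; split.
    by rewrite mulr_ge0//; lra.
  have := near (tnth t i); have := q2 (tnth t i).
  by rewrite ler_norml => ? /andP[? _]; nra.
apply: (@le_trans _ _ ((2^-1)%:E * lik_mass Q q B')).
  apply: (@le_trans _ _ ((2^-1)%:E * (8^-1)%:E)).
    by rewrite -EFinM lee_fin; lra.
  by apply: lee_wpmul2l hard; rewrite lee_fin.
rewrite /lik_mass -ge0_integralZl//; last 2 first.
- exact: measurable_indic_lik.
- by move=> t _; rewrite lee_fin mulr_ge0// lik_ge0.
apply: ge0_le_integral => //.
- by move=> t _; rewrite -EFinM lee_fin !mulr_ge0// lik_ge0.
- by apply: measurable_funeM; exact: measurable_indic_lik.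
- exact: measurable_indic_lik.
- move=> t _; rewrite -EFinM lee_fin mulrCA !indicE.
  have [/set_mem tB'|_] := boolP (t \in B').
    by rewrite mem_set ?mul1r//; exact: BB'.
  by rewrite mul0r mulr_ge0 ?lik_ge0.
Qed.

End limit_density.

(** * Comparison of distances, maximal cliques, and conclusion *)

Lemma l1_distance_le_euclidean (R : realType) d (x y : Rd R d) :
  l1_distance x y <= d%:R * euclidean_dist x y.
Proof.
rewrite /l1_distance mulr_natl -[d in _ *+ d]card_ord -sumr_const.
apply: ler_sum => i _; rewrite -sqrtr_sqr ler_wsqrtr//.
by rewrite (bigD1 i)//= lerDl sumr_ge0// => j _; exact: sqr_ge0.
Qed.

Lemma exists_max_clique d (e : rel 'I_d) : exists2 K : {set 'I_d}, clique e K &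
  #|K| = clique_number e.
Proof.
have c0 : clique e finset.set0 by apply/forall_inP => i; rewrite finset.in_set0.
have [K cK KE] := @eq_bigmax_cond _ (clique e) (fun K => #|K|) ltac:(by apply/card_gt0P; exists finset.set0).
by exists K.
Qed.

Lemma clique_number_gt0 d (e : rel 'I_d) : (0 < d)%N -> (0 < clique_number e)%N.
Proof.
move=> d0; pose i := Ordinal d0.
have ci : clique e (finset.set1 i).
  apply/forall_inP => j /finset.set1P ->; apply/forall_inP => k /finset.set1P ->.
  by rewrite eqxx.
by rewrite -(cards1 i); exact: (leq_bigmax_cond (F := fun K : {set 'I_d} => #|K|)).
Qed.

Unset Implicit Arguments.

Theorem mainTheorem3 (R : realType) (d : nat) (d_ge1 : (1 <= d)%N)
    (e : rel 'I_d) (e_sym : symmetric e) (eps : R)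
    (eps_gt0 : 0 < eps) (eps_lt : eps < 2 + (clique_number e)%:R) :
  ~ exists2 phat : estimator R d, measurable_estimator phat &
      forall p : density R d, lipschitz_density p -> markov_property e p ->
        bigO_proba (fun n => power_measure (density_law p) n)
          (fun n sample => L1_dist p (phat n sample))
          (fun n => n%:R `^ (- (2 + (clique_number e)%:R - eps)^-1)).
Proof.
move=> [phat mphat rate_phat].
have [K cK KE] := exists_max_clique e.
have [i0 i0K] : exists i0, i0 \in K.
  by apply/card_gt0P; rewrite KE clique_number_gt0.
rewrite -KE in eps_lt rate_phat.
have [q_ [z_ [adm ref]]] := exists_refining_sequence i0K eps_gt0 eps_lt mphat.
pose q := limit_density q_ z_.
have mq : measurable_fun setT q by exact: (measurable_limit_density adm ref).
have q_ge x : 2^-1 <= q x by exact: limit_density_ge adm x.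
have q0 x : 0 <= q x by apply: le_trans (q_ge x).
have q1 := integral_limit_density adm ref.
pose p := density_of mq q0 q1.
have lip : lipschitz_density p.
  exists d%:R => // x y _ _.
  by apply: le_trans (limit_density_lipschitz adm ref x y) (l1_distance_le_euclidean x y).
have markov : markov_property e p.
  exact: (markov_of_clique mq q0 q1 cK (@depends_on_limit_density _ _ _ _ _ adm)).
(* Any level below the [1/16] of [limit_density_hard] would do. *)
have [M [N0 _ MP]] := rate_phat p lip markov 32^-1 ltac:(by rewrite invr_gt0 ltr0n).
(* Large enough that [n >= k] is past [N0], and that the multiple [k - 1] of the rate, one having
   been lost in the limit, still dominates [M]. *)
pose k := maxn N0 (Num.bound `|M|).+1.
have [n [kn rate0 hard]] := limit_density_hard mphat adm ref k.
have /= := MP n (leq_trans (leq_maxl _ _) kn).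
set A := (X in power_measure _ n X); set B := (X in lik_mass _ _ X) in hard.
have kM : M <= k%:R - 1.
  rewrite lerBrDr; apply: (@le_trans _ _ (Num.bound `|M|).+1%:R).
    rewrite -natr1 lerD2r; apply: le_trans (ler_norm M) _.
    by apply/ltW/archi_boundP.
  by rewrite ler_nat leq_maxr.
have mphat_n : measurable_fun setT
  (fun tx : n.-tuple (Rd R d) * Rd R d => phat n tx.1 tx.2) := mphat n.
have AE : A = [set t | (M * rate K eps n)%:E < L1_error (uniform_cube R d) q (phat n) t]%E.
  apply/funext => t; rewrite /A/= L1_dist_of// gee0_abs//.
  by apply: integral_ge0 => x _; rewrite lee_fin.
have mA : measurable A by rewrite AE; exact: measurable_L1_error_gt.
have mB : measurable B by exact: measurable_L1_error_gt.
rewrite power_density_law//.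
have BA : B `<=` A.
  rewrite AE => t; apply: le_lt_trans; rewrite lee_fin.
  by rewrite ler_wpM2r// ltW.
move=> AS; have : (16^-1%:E <= 32^-1%:E :> \bar R)%E.
  apply: le_trans hard (le_trans _ AS); apply: ge0_le_integral => //.
  - by move=> t _; rewrite lee_fin mulr_ge0// lik_ge0.
  - exact: measurable_indic_lik.
  - exact: measurable_indic_lik.
  - move=> t _; rewrite lee_fin ler_wpM2r ?lik_ge0// !indicE.
    have [/set_mem tB|//] := boolP (t \in B).
    by rewrite mem_set//; exact: BA.
by rewrite lee_fin; lra.
Qed.
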